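(* Let $V$ be a nonlocal vertex $\mathbb{F}((t))$-algebra with an increasing filtration $\mathcal{F}=\{F_n\}_{n\in\frac12\mathbb{Z}}$ of $\mathbb{F}((t))$-submodules, satisfying the condition that $F_n=0$ for $n$ sufficiently negative, $\mathbf{1}\in F_0$, and $$u_kF_n\subset F_{m+n-k-1}\quad\text{for }u\in F_m,\ k\in\mathbb{Z},\ m,n\in\tfrac12\mathbb{Z}.$$ Assume that $\mathrm{Gr}_{\mathcal{F}}(V)$ as a $\mathrm{Gr}_{\mathcal{F}}(V)$-module is irreducible with $\mathrm{End}(\mathrm{Gr}_{\mathcal{F}}(V)^{\mathrm{mod}})=\mathbb{F}((t))$. Then $V$ as a $V$-module is irreducible with $\mathrm{End}_V(V^{\mathrm{mod}})=\mathbb{F}((t))$, and $V$ is non-degenerate.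
   Context: $\mathbb{F}$ is a field of characteristic $0$; $t,x,x_0,x_1,\dots$ are commuting formal variables. $V((x))$ is the space of lower truncated Laurent series. $\mathbb{F}_*(x_1,\dots,x_r)$ is the localization of $\mathbb{F}[[x_1,\dots,x_r]]$ at the nonzero polynomials; $\iota_{x_{i_1},\dots,x_{i_r}}:\mathbb{F}_*(x_1,\dots,x_r)\to\mathbb{F}((x_{i_1}))\cdots((x_{i_r}))$ is the unique algebra embedding extending the identity of $\mathbb{F}[[x_1,\dots,x_r]]$. Powers of $x_0+x_2$ are expanded in nonnegative powers of the second variable; $f(t+x)=e^{x\,d/dt}f(t)$; for $f\in\mathbb{F}_*(x_1,\dots,x_n)$, $f(t+x_1,\dots,t+x_n)=e^{t(\partial_{x_1}+\cdots+\partial_{x_n})}f\in\mathbb{F}_*(t,x_1,\dots,x_n)$. Nonlocal vertex algebra over $\mathbb{F}$: a vector space $V$ with a linear map $Y(\cdot,x):V\to\mathrm{Hom}(V,V((x)))$, $Y(v,x)=\sum_{n\in\mathbb{Z}}v_nx^{-n-1}$, and $\mathbf{1}\in V$ with $Y(\mathbf{1},x)v=v$, $Y(v,x)\mathbf{1}\in V[[x]]$, $\lim_{x\to0}Y(v,x)\mathbf{1}=v$, and for all $u,v,w\in V$ there is $l\in\mathbb{N}$ with $(x_0+x_2)^lY(u,x_0+x_2)Y(v,x_2)w=(x_0+x_2)^lY(Y(u,x_0)v,x_2)w$. Nonlocal vertex $\mathbb{F}((t))$-algebra: a nonlocal vertex algebra over $\mathbb{F}$ which is also an $\mathbb{F}((t))$-module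 with $Y(f(t)u,x)(g(t)v)=f(t+x)g(t)Y(u,x)v$. A filtration of $V$ is understood to have union $V$. $\mathrm{Gr}_{\mathcal{F}}(V)=\bigoplus_{n\in\frac12\mathbb{Z}}(F_n/F_{n-1/2})$, a nonlocal vertex $\mathbb{F}((t))$-algebra with vacuum vector $\mathbf{1}+F_{-1/2}$ and with $(u+F_{m-1/2})_k(v+F_{n-1/2})=u_kv+F_{m+n-k-3/2}\in F_{m+n-k-1}/F_{m+n-k-3/2}$ for $u\in F_m,v\in F_n,k\in\mathbb{Z}$. For a nonlocal vertex $\mathbb{F}((t))$-algebra $K$, $K^{\mathrm{mod}}$ is the adjoint module; submodules are $\mathbb{F}$-subspaces stable under all $v_n$ (automatically $\mathbb{F}((t))$-submodules), endomorphisms are $\mathbb{F}$-linear maps commuting with all $v_n$ (automatically $\mathbb{F}((t))$-linear), and ''$\mathrm{End}=\mathbb{F}((t))$'' means that all endomorphisms are multiplications by elements of $\mathbb{F}((t))$. Non-degeneracy: $V^{\otimes n}\boxtimes\mathbb{F}_*(x_1,\dots,x_n)$ is the quotient of $V^{\otimes n}\otimes\mathbb{F}_*(x_1,\dots,x_n)$ (tensor products over $\mathbb{F}$) by the relations $f_1(t)v^{(1)}\otimes\cdots\otimes f_n(t)v^{(n)}\otimes f=v^{(1)}\otimes\cdots\otimes v^{(n)}\otimes f_1(x_1)\cdots f_n(x_n)f$, $f_i(t)\in\mathbb{F}((t))$. $V$ is non-degenerate if for every $n\ge1$ the $\mathbb{F}$-linear map $Z_n:V^{\otimes n}\boxtimes\mathbb{F}_*(x_1,\dots,x_n)\to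 V((x_1))\cdots((x_n))$, $(v^{(1)}\otimes\cdots\otimes v^{(n)})\boxtimes f\mapsto\iota_{t,x_1,\dots,x_n}f(t+x_1,\dots,t+x_n)Y(v^{(1)},x_1)\cdots Y(v^{(n)},x_n)\mathbf{1}$, is injective. *)

(* Defs.v *)
From HB Require Import structures.
From mathcomp Require Import all_boot all_order all_algebra.
From mathcomp Require Import boolp classical_sets functions cardinality fsbigop.
From mathcomp Require Import zify.
From mathcomp.multinomials Require Import monalg.

Set Implicit Arguments.
Unset Strict Implicit.
Unset Printing Implicit Defensive.

Import Order.TTheory GRing.Theory Num.Theory.
Local Open Scope classical_set_scope.
Local Open Scope ring_scope.

(* R[[x]].  An alias of nat -> R, so that the product is the Cauchy product    *)
(* and not the pointwise product of functions.                                 *)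
Definition pseries (R : Type) := nat -> R.

HB.instance Definition _ (R : zmodType) :=
  GRing.Zmodule.copy (pseries R) (nat -> R).

Section PSeriesRing.
Variable R : comNzRingType.
Implicit Types f g h : pseries R.

Definition psC (c : R) : pseries R := fun n => if n == 0%N then c else 0.
Definition psmul f g : pseries R := fun n => \sum_(i < n.+1) f i * g (n - i)%N.

Let trunc N f : {poly R} := \poly_(i < N) f i.

Let psmulE N f g n : (n < N)%N -> psmul f g n = (trunc N f * trunc N g)`_n.
Proof.
move=> nN; rewrite coefM; apply: eq_bigr => i _.
by rewrite !coef_poly !ifT // (leq_ltn_trans _ nN) ?leq_subr// -ltnS.
Qed.

Let psmulA : associative psmul.
Proof.
move=> f g h; apply/funext => n.
transitivity ((trunc n.+1 f * trunc n.+1 g * trunc n.+1 h)`_n).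
  rewrite -mulrA coefM; apply: eq_bigr => i _.
  by rewrite coef_poly ifT// (@psmulE n.+1) ?ltnS ?leq_subr.
rewrite coefM; apply: eq_bigr => i _.
rewrite (@psmulE n.+1) ?(leq_ltn_trans _ (ltn_ord i))//.
by rewrite [(trunc _ h)`__]coef_poly ifT// ltnS leq_subr.
Qed.

Let psmulC : commutative psmul.
Proof.
by move=> f g; apply/funext => n; rewrite !(@psmulE n.+1)// mulrC.
Qed.

Let psmul1 : left_id (psC 1) psmul.
Proof.
move=> f; apply/funext => n; rewrite /psmul big_ord_recl /psC /= mul1r subn0.
by rewrite big1 ?addr0// => i _; rewrite mul0r.
Qed.

Let psmulDl : left_distributive psmul +%R.
Proof.
move=> f g h; apply/funext => n.
transitivity (psmul f h n + psmul g h n) => //.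
by rewrite /psmul -big_split /=; apply: eq_bigr => i _; rewrite -mulrDl.
Qed.

Let ps1_neq0 : psC 1 != 0.
Proof. by apply/eqP => /(congr1 (@^~ 0%N))/eqP; rewrite /psC/= oner_eq0. Qed.

HB.instance Definition _ := GRing.Zmodule_isComNzRing.Build (pseries R)
  psmulA psmulC psmul1 psmulDl ps1_neq0.

Lemma ps_coefM f g n : (f * g) n = \sum_(i < n.+1) f i * g (n - i)%N.
Proof. by []. Qed.

Definition ps_unit : {pred (pseries R)} := fun f => `[< exists g, g * f = 1 >].
Definition ps_inv f : pseries R :=
  if pselect (exists g, g * f = 1) is left e then projT1 (cid e) else f.

Let psmulVx : {in ps_unit, left_inverse 1 ps_inv *%R}.
Proof.
move=> f; rewrite unfold_in => /asboolP fu; rewrite /ps_inv.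
by case: pselect => // e; case: cid.
Qed.
Let psunitPl : forall f g, g * f = 1 -> f \in ps_unit.
Proof. by move=> f g gf; rewrite unfold_in; apply/asboolP; exists g. Qed.
Let psinv_out : {in [predC ps_unit], ps_inv =1 id}.
Proof.
move=> f; rewrite inE unfold_in => /asboolPn fu; rewrite /ps_inv.
by case: pselect.
Qed.
HB.instance Definition _ := GRing.ComNzRing_hasMulInverse.Build (pseries R)
  psmulVx psunitPl psinv_out.

End PSeriesRing.

Lemma ps_neq0P (R : zmodType) (f : pseries R) : f != 0 ->
  exists n, f n != 0 /\ forall m, (m < n)%N -> f m = 0.
Proof.
move=> f0; have ex : exists n, f n != 0.
  apply: contrapT => h; move/eqP: f0; apply; apply/funext => n.
  by apply/eqP/negPn/negP => fn; apply: h; exists n.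
case: (ex_minnP ex) => n fn nmin; exists n; split=> // m mn.
by apply/eqP; apply: contraTT mn => fm; rewrite -leqNgt; apply: nmin.
Qed.

Section PSeriesDomain.
Variable R : idomainType.

Let ps_integral (f g : pseries R) : f * g = 0 -> (f == 0) || (g == 0).
Proof.
move=> fg0; apply: contrapT => /negP; rewrite negb_or => /andP[f0 g0].
have [a [fa fl]] := ps_neq0P f0; have [b [gb gl]] := ps_neq0P g0.
have /eqP := congr1 (@^~ (a + b)%N) fg0; apply/negP.
have aS : (a < (a + b).+1)%N by rewrite ltnS leq_addr.
rewrite ps_coefM (bigD1 (Ordinal aS)) //= addKn big1 ?addr0 ?mulf_neq0// => i ia.
have [ilt|] := ltnP i a; first by rewrite fl// mul0r.
rewrite leq_eqVlt => /orP[/eqP ai|ai].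
  by move/eqP: ia; case; apply/val_inj.
rewrite gl ?mulr0//.
have ib : (i <= a + b)%N by rewrite -ltnS.
by rewrite ltn_subLR // ltn_add2r.
Qed.

HB.instance Definition _ := GRing.ComUnitRing_isIntegral.Build (pseries R) ps_integral.
End PSeriesDomain.

Lemma ps_inverse (K : fieldType) (f : pseries K) : f 0%N != 0 ->
  exists g, g * f = 1.
Proof.
move=> f0; pose r : pseries K := 1 - psC (f 0%N)^-1 * f.
have C0 c (h : pseries K) n : (psC c * h) n = c * h n.
  rewrite ps_coefM big_ord_recl /psC /= subn0.
  by rewrite big1 ?addr0 // => i _; rewrite mul0r.
have r0 : r 0%N = 0.
  have -> : r 0%N = 1 - (psC (f 0%N)^-1 * f) 0%N by [].
  by rewrite C0 mulVf ?subrr.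
have rX k n : (n < k)%N -> (r ^+ k) n = 0.
  elim: k n => // k IH n nk; rewrite exprS ps_coefM big1// => -[[|i] /= il] _.
    by rewrite r0 mul0r.
  by rewrite IH ?mulr0//; move: il nk; lia.
pose S N : pseries K := \sum_(i < N) r ^+ i.
have sumE N (F : 'I_N -> pseries K) n : (\sum_(i < N) F i) n = \sum_(i < N) F i n.
  exact: (big_morph (fun f : pseries K => f n)).
have SE N n : (n < N)%N -> S N n = S n.+1 n.
  move=> nN; rewrite /S !sumE -!(big_mkord xpredT (fun i => (r ^+ i) n)).
  rewrite (big_cat_nat (n := n.+1))//= [X in _ + X]big_nat_cond.
  rewrite [X in _ + X]big1 ?addr0 // => i /andP[/andP[ni _] _].
  by rewrite rX.
pose q : pseries K := fun n => S n.+1 n.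
have qE : q * (psC (f 0%N)^-1 * f) = 1.
  have -> : psC (f 0%N)^-1 * f = 1 - r by rewrite opprB addrC subrK.
  apply/funext => n.
  have -> : (q * (1 - r)) n = (S n.+1 * (1 - r)) n.
    rewrite !ps_coefM; apply: eq_bigr => i _; congr (_ * _).
    by rewrite /q [RHS]SE // ltnS -ltnS.
  have := subrX1 r n.+1; rewrite -/(S n.+1) mulrC => e.
  rewrite -[1 - r]opprB mulrN -e opprB.
  have -> : (1 - r ^+ n.+1 : pseries K) n = (1 : pseries K) n - (r ^+ n.+1) n by [].
  by rewrite rX // subr0.
by exists (q * psC (f 0%N)^-1); rewrite -mulrA.
Qed.

Definition lower_truncated (U : zmodType) : {pred int -> U} :=
  fun f => `[< exists N : int, forall n, n < N -> f n = 0 >].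

Lemma lower_truncatedP (U : zmodType) (f : int -> U) :
  reflect (exists N : int, forall n, n < N -> f n = 0) (f \in @lower_truncated U).
Proof. by rewrite unfold_in; apply: asboolP. Qed.

Lemma lower_truncated_zmod (U : zmodType) : zmod_closed (@lower_truncated U).
Proof.
split; first by apply/lower_truncatedP; exists 0.
move=> f g /lower_truncatedP[M fM] /lower_truncatedP[N gN].
apply/lower_truncatedP; exists (Num.min M N) => n; rewrite lt_min => /andP[nM nN].
by transitivity (f n - g n) => //; rewrite fM ?gN ?subrr.
Qed.
HB.instance Definition _ (U : zmodType) :=
  GRing.isZmodClosed.Build (int -> U) (@lower_truncated U) (@lower_truncated_zmod U).

Lemma lower_truncated_scale (R : pzRingType) (U : lmodType R) :
  GRing.scaler_closed (@lower_truncated U).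
Proof.
move=> a f /lower_truncatedP[M fM]; apply/lower_truncatedP; exists M => n nM.
by transitivity (a *: f n) => //; rewrite fM ?scaler0.
Qed.
HB.instance Definition _ (R : pzRingType) (U : lmodType R) :=
  GRing.isScaleClosed.Build R (int -> U) (@lower_truncated U) (@lower_truncated_scale R U).

(* U((x)); the coefficient of x^n in f is f n.                                 *)
Record laurent (U : zmodType) :=
  Laurent { lcoef :> int -> U; lcoefP : lcoef \in @lower_truncated U }.

HB.instance Definition _ (U : zmodType) := [isSub for @lcoef U].
HB.instance Definition _ (U : zmodType) := [Choice of laurent U by <:].
HB.instance Definition _ (U : zmodType) := [SubChoice_isSubZmodule of laurent U by <:].
HB.instance Definition _ (R : pzRingType) (U : lmodType R) :=
  [SubZmodule_isSubLmodule of laurent U by <:].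

Lemma laurentP (U : zmodType) (f g : laurent U) : f =1 g -> f = g.
Proof. by move=> fg; apply/val_inj/funext. Qed.

(* lof f is 0 if f is not lower truncated; lof is only meant for truncated f   *)
(* (lofE).                                                                     *)
Definition lof (U : zmodType) (f : int -> U) : laurent U := insubd 0 f.

Lemma lofE (U : zmodType) (f : int -> U) (N : int) :
  (forall n, n < N -> f n = 0) -> lof f =1 f.
Proof.
move=> fN n; rewrite /lof -[lcoef _ n]/(val _ n) insubdK//.
by apply/lower_truncatedP; exists N.
Qed.

(* x^N p(x)                                                                    *)
Definition lpow (U : zmodType) (N : int) (p : pseries U) : laurent U :=
  lof (fun n => if N <= n then p `|n - N|%N else 0).

Definition lps (U : zmodType) (p : pseries U) : laurent U := lpow 0 p.
Definition lconst (U : zmodType) (c : U) : laurent U :=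
  lof (fun n => if n == 0 then c else 0).

(* The product of series induced by op, which is biadditive in all uses, so    *)
(* that the sums are finite and the result is truncated (lconvE).              *)
Definition lconv (A B C : zmodType) (op : A -> B -> C)
  (f : laurent A) (g : laurent B) : laurent C :=
  lof (fun n => \sum_(i \in [set: int]) op (f i) (g (n - i))).
Definition lmap (U W : zmodType) (phi : U -> W) (f : laurent U) : laurent W :=
  lof (fun n => phi (f n)).

Lemma lpowE (U : zmodType) N (p : pseries U) n :
  lpow N p n = if N <= n then p `|n - N|%N else 0.
Proof. by rewrite (@lofE _ _ N)// => m; rewrite leNgt => ->. Qed.

Lemma lconstE (U : zmodType) (c : U) n : lconst c n = if n == 0 then c else 0.
Proof. by rewrite (@lofE _ _ 0)// => m; case: eqP => // ->. Qed.

Lemma lpow_surj (U : zmodType) (f : laurent U) :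
  exists N0, forall N, N <= N0 -> exists p, f = lpow N p.
Proof.
have /lower_truncatedP[N0 fN] := lcoefP f; exists N0 => N NN0.
exists (fun k => f (N + k%:Z)); apply: laurentP => n; rewrite lpowE.
case: leP => nN; last by rewrite fN// (lt_le_trans nN).
by congr (f _); lia.
Qed.

Section Conv.
Variables (A B C : zmodType) (op : A -> B -> C).
Hypothesis op0l : forall b, op 0 b = 0.
Hypothesis op0r : forall a, op a 0 = 0.

Lemma lconvE f g n :
  lconv op f g n = \sum_(i \in [set: int]) op (f i) (g (n - i)).
Proof.
have [M fM] := lower_truncatedP _ (lcoefP f).
have [N gN] := lower_truncatedP _ (lcoefP g).
rewrite /lconv (@lofE _ _ (M + N)) // => m mMN.
rewrite fsbig1// => i _; have [iM|Mi] := ltP i M; first by rewrite fM ?op0l.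
by rewrite gN ?op0r//; lia.
Qed.

Lemma lconv_pow a b p q :
  lconv op (lpow a p) (lpow b q) =
  lpow (a + b) (fun n => \sum_(i < n.+1) op (p i) (q (n - i)%N)).
Proof.
apply: laurentP => n; rewrite lconvE lpowE; case: leP => nab; last first.
  rewrite fsbig1// => i _; rewrite !lpowE; case: leP => // ai.
  by rewrite ifF ?op0r//; apply/negbTE; lia.
set m := `|_|%N.
pose h (j : nat) : int := a + j%:Z.
rewrite -(@fsbig_widen _ _ _ _ (h @` `I_m.+1))//; last first.
  move=> i [_ /= hi]; rewrite !lpowE; case: leP => // ai; case: leP => // bi.
  case: hi; exists `|i - a|%N; rewrite /h /=; lia.
rewrite fsbig_image; last by move=> i j _ _; rewrite /h; lia.
rewrite -fsbig_ord; apply: eq_bigr => -[i /= im] _; rewrite !lpowE /h.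
by rewrite !ifT; [congr (op (p _) (q _))|..]; lia.
Qed.
End Conv.

Lemma lpowD (U : zmodType) a (p q : pseries U) : lpow a p + lpow a q = lpow a (p + q).
Proof.
apply: laurentP => n; transitivity (lpow a p n + lpow a q n) => //.
by rewrite !lpowE; case: ifP; rewrite ?addr0.
Qed.

Lemma lconst_pow (R : comNzRingType) (c : R) : lconst c = lpow 0 (psC c).
Proof.
apply: laurentP => n; rewrite lconstE lpowE /psC.
case: leP => n0; last by rewrite ifF//; lia.
by congr (if _ then _ else _); lia.
Qed.

Section LaurentRing.
Variable R : comNzRingType.
Implicit Types f g h : laurent R.

Definition lmul f g : laurent R := lconv *%R f g.

Let lmul_pow a b (p q : pseries R) :
  lmul (lpow a p) (lpow b q) = lpow (a + b) (p * q).
Proof. by rewrite /lmul lconv_pow//; [exact: mul0r|exact: mulr0]. Qed.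

Lemma lpow_ind (P : laurent R -> Prop) : (forall a p, P (lpow a p)) -> forall f, P f.
Proof. by move=> h f; have [N /(_ N (lexx N))[p ->]] := lpow_surj f. Qed.

Let lmulA : associative lmul.
Proof.
elim/lpow_ind => a p; elim/lpow_ind => b q; elim/lpow_ind => c r.
by rewrite !lmul_pow addrA mulrA.
Qed.
Let lmulC : commutative lmul.
Proof.
by elim/lpow_ind => a p; elim/lpow_ind => b q; rewrite !lmul_pow addrC mulrC.
Qed.
Let lmul1 : left_id (lconst 1) lmul.
Proof.
by elim/lpow_ind => a p; rewrite lconst_pow lmul_pow add0r mul1r.
Qed.
Let lmulDl : left_distributive lmul +%R.
Proof.
move=> f g; elim/lpow_ind => c r.
have [M fM] := lpow_surj f; have [N gN] := lpow_surj g.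
have [|p ->] := fM (Num.min M N); first by rewrite ge_min lexx.
have [|q ->] := gN (Num.min M N); first by rewrite ge_min lexx orbT.
by rewrite lpowD !lmul_pow lpowD mulrDl.
Qed.
Let l1_neq0 : lconst (1 : R) != 0.
Proof.
apply/eqP => /(congr1 (fun f : laurent R => f 0)); rewrite lconstE eqxx => /eqP.
by rewrite oner_eq0.
Qed.
HB.instance Definition _ := GRing.Zmodule_isComNzRing.Build (laurent R)
  lmulA lmulC lmul1 lmulDl l1_neq0.

Lemma lpowM a b (p q : pseries R) : lpow a p * lpow b q = lpow (a + b) (p * q).
Proof. exact: lmul_pow. Qed.
Lemma lpow1 : lpow 0 (1 : pseries R) = 1.
Proof. by rewrite -[1 : laurent R]/(lconst 1) lconst_pow. Qed.
End LaurentRing.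

Section LaurentField.
Variable K : fieldType.

Let linv_ex (f : laurent K) : f != 0 -> exists g, g * f = 1.
Proof.
have [N /(_ N (lexx N))[p ->]] := lpow_surj f => f0.
have /ps_neq0P[k [pk pl]] : p != 0.
  apply: contraNneq f0 => ->; apply/eqP/laurentP => n; rewrite lpowE.
  by case: ifP.
have -> : lpow N p = lpow (N + k%:Z) (fun i => p (k + i)%N).
  apply: laurentP => n; rewrite !lpowE; case: leP => nN; last by rewrite ifF//; lia.
  case: leP => nk; first by congr p; lia.
  by rewrite pl//; lia.
have [|q qp] := @ps_inverse K (fun i => p (k + i)%N); first by rewrite addn0.
by exists (lpow (- (N + k%:Z)) q); rewrite lpowM qp addNr lpow1.
Qed.

Definition linv (f : laurent K) : laurent K :=
  if pselect (exists g, g * f = 1) is left e then projT1 (cid e) else 0.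

Let lmulVf (f : laurent K) : f != 0 -> linv f * f = 1.
Proof. by move=> f0; have h := linv_ex f0; rewrite /linv; case: pselect => // e; case: cid. Qed.
Let linv0 : linv 0 = 0.
Proof.
rewrite /linv; case: pselect => // e; exfalso; case: e => g /eqP.
by rewrite mulr0 eq_sym oner_eq0.
Qed.
HB.instance Definition _ := GRing.ComNzRing_isField.Build (laurent K) lmulVf linv0.
End LaurentField.

Section Submodules.
Variables (R : pzRingType) (M : lmodType R).

Record is_submod (S : set M) : Prop := IsSubmod {
  submod0 : S 0;
  submodD : forall x y, S x -> S y -> S (x + y);
  submodZ : forall c x, S x -> S (c *: x) }.

Record submod := Submod { sset :> M -> Prop; ssetP : is_submod sset }.

Definition lspan (G : set M) : {pred M} :=
  fun x => `[< forall S, is_submod S -> G `<=` S -> S x >].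

Definition sub_pred (S : submod) : {pred M} := fun x => `[< S x >].

Lemma is_submod_closed (p : {pred M}) :
  is_submod [set x | x \in p] -> submod_closed p.
Proof. by case=> p0 pD pZ; split=> // c x y px py; apply: pD => //; apply: pZ. Qed.

Lemma lspanP G x :
  reflect (forall S, is_submod S -> G `<=` S -> S x) (x \in lspan G).
Proof. by rewrite unfold_in; apply: asboolP. Qed.

Lemma lspan_submod G : is_submod [set x | x \in lspan G].
Proof.
split=> [|x y /lspanP Gx /lspanP Gy|c x /lspanP Gx]; apply/lspanP => S Ssub GS.
- exact: submod0.
- by apply: submodD => //; [exact: Gx|exact: Gy].
- by apply: submodZ => //; exact: Gx.
Qed.

Lemma sub_predP (S : submod) x : reflect (S x) (x \in sub_pred S).
Proof. by rewrite unfold_in; apply: asboolP. Qed.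

Lemma sub_pred_submod S : is_submod [set x | x \in sub_pred S].
Proof.
have [S0 SD SZ] := ssetP S; split=> [|x y /sub_predP Sx /sub_predP Sy|c x /sub_predP Sx];
  apply/sub_predP; [exact: S0|exact: SD|exact: SZ].
Qed.

HB.instance Definition _ G := GRing.isSubmodClosed.Build R M (lspan G)
  (is_submod_closed (@lspan_submod G)).
HB.instance Definition _ S := GRing.isSubmodClosed.Build R M (sub_pred S)
  (is_submod_closed (@sub_pred_submod S)).

Record subl (S : submod) := Subl { subl_val : M; sublP : subl_val \in sub_pred S }.
HB.instance Definition _ S := [isSub for @subl_val S].
HB.instance Definition _ S := [Choice of subl S by <:].
HB.instance Definition _ S := [SubChoice_isSubZmodule of subl S by <:].
HB.instance Definition _ S := [SubZmodule_isSubLmodule of subl S by <:].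

(* M / <G>, where <G> = lspan G is the submodule generated by G.               *)
Definition lquot (G : set M) : Type := Quotient.quot (lspan G : zmodClosed M).
HB.instance Definition _ G := GRing.Zmodule.on (lquot G).
Definition lpi G (x : M) : lquot G := (\pi_(Quotient.quot (lspan G)) x)%qT.
Definition lrepr G (q : lquot G) : M := repr q.

Lemma lreprK G : cancel (@lrepr G) (@lpi G).
Proof. exact: reprK. Qed.
Lemma lpi_eqE G x y : (lpi G x = lpi G y) <-> (x - y \in lspan G).
Proof. by rewrite /lpi Quotient.idealrBE; split => [/eqP|/eqP]. Qed.

Lemma lpi_is_zmod G : zmod_morphism (@lpi G).
Proof. exact: raddfB. Qed.
HB.instance Definition _ G := GRing.isZmodMorphism.Build M (lquot G) (@lpi G) (@lpi_is_zmod G).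

Definition lqscale G (c : R) (q : lquot G) : lquot G := lpi G (c *: lrepr q).
Lemma lqscaleE G c x : lqscale c (lpi G x) = lpi G (c *: x).
Proof.
apply/lpi_eqE; rewrite -scalerBr rpredZ//.
by apply/lpi_eqE; rewrite lreprK.
Qed.

Lemma lquot_ind G (P : lquot G -> Prop) : (forall x, P (lpi G x)) -> forall q, P q.
Proof. by move=> h q; rewrite -(lreprK q). Qed.

Fact lqscaleA G a b (v : lquot G) : lqscale a (lqscale b v) = lqscale (a * b) v.
Proof. by elim/lquot_ind: v => x; rewrite !lqscaleE scalerA. Qed.
Fact lqscale1 G : left_id 1 (@lqscale G).
Proof. by elim/lquot_ind => x; rewrite !lqscaleE scale1r. Qed.
Fact lqscaleDr G : right_distributive (@lqscale G) +%R.
Proof.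
move=> a; elim/lquot_ind => x; elim/lquot_ind => y.
by rewrite -raddfD !lqscaleE scalerDr raddfD.
Qed.
Fact lqscaleDl G (v : lquot G) : {morph (fun a => lqscale a v) : a b / a + b}.
Proof. by move=> a b; elim/lquot_ind: v => x; rewrite !lqscaleE scalerDl raddfD. Qed.
HB.instance Definition _ G := GRing.Zmodule_isLmodule.Build R (lquot G)
  (@lqscaleA G) (@lqscale1 G) (@lqscaleDr G) (@lqscaleDl G).

Lemma lpi_scalable G : scalable (@lpi G).
Proof. by move=> c x; rewrite -lqscaleE. Qed.
HB.instance Definition _ G := GRing.isScalable.Build R M (lquot G) *:%R (@lpi G) (@lpi_scalable G).
End Submodules.

Section DirectSum.
Variables (R : pzRingType) (I : eqType) (Q : I -> lmodType R).

(* The direct sum of the Q i is dsum, the finitely supported elements of the   *)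
(* product dprod.                                                              *)
Definition dprod : Type := forall i, Q i.
HB.instance Definition _ := gen_eqMixin dprod.
HB.instance Definition _ := gen_choiceMixin dprod.

Definition dprod0 : dprod := fun i => 0.
Definition dprod_opp (f : dprod) : dprod := fun i => - f i.
Definition dprod_add (f g : dprod) : dprod := fun i => f i + g i.
Definition dprod_scale (c : R) (f : dprod) : dprod := fun i => c *: f i.
Fact dprodA : associative dprod_add.
Proof. by move=> f g h; apply/functional_extensionality_dep => i; apply: addrA. Qed.
Fact dprodC : commutative dprod_add.
Proof. by move=> f g; apply/functional_extensionality_dep => i; apply: addrC. Qed.
Fact dprod0D : left_id dprod0 dprod_add.
Proof. by move=> f; apply/functional_extensionality_dep => i; apply: add0r. Qed.
Fact dprodND : left_inverse dprod0 dprod_opp dprod_add.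
Proof. by move=> f; apply/functional_extensionality_dep => i; apply: addNr. Qed.
HB.instance Definition _ := GRing.isZmodule.Build dprod dprodA dprodC dprod0D dprodND.
Fact dprod_scaleA a b f : dprod_scale a (dprod_scale b f) = dprod_scale (a * b) f.
Proof. by apply/functional_extensionality_dep => i; apply: scalerA. Qed.
Fact dprod_scale1 : left_id 1 dprod_scale.
Proof. by move=> f; apply/functional_extensionality_dep => i; apply: scale1r. Qed.
Fact dprod_scaleDr : right_distributive dprod_scale +%R.
Proof. by move=> a f g; apply/functional_extensionality_dep => i; apply: scalerDr. Qed.
Fact dprod_scaleDl f : {morph (fun a => dprod_scale a f) : a b / a + b}.
Proof. by move=> a b; apply/functional_extensionality_dep => i; apply: scalerDl. Qed.
HB.instance Definition _ := GRing.Zmodule_isLmodule.Build R dprod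
  dprod_scaleA dprod_scale1 dprod_scaleDr dprod_scaleDl.

Definition dfinite : {pred dprod} := fun f => `[< finite_set [set i | f i != 0] >].

Lemma dfiniteP f : reflect (finite_set [set i | f i != 0]) (f \in dfinite).
Proof. by rewrite unfold_in; apply: asboolP. Qed.

Lemma dfinite_submod : submod_closed dfinite.
Proof.
split=> [|c f g /dfiniteP ff /dfiniteP gf]; apply/dfiniteP.
  by rewrite (_ : [set _ | _] = set0)// -subset0 => i /=; rewrite eqxx.
apply: (@sub_finite_set _ _ ([set i | f i != 0] `|` [set i | g i != 0])).
  move=> i /= fgi; apply/orP; apply: contraNT fgi.
  rewrite negb_or !negbK => /andP[/eqP fi /eqP gi]; apply/eqP.
  by transitivity (c *: f i + g i) => //; rewrite fi gi scaler0 addr0.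
by rewrite finite_setU.
Qed.
HB.instance Definition _ := GRing.isSubmodClosed.Build R dprod dfinite dfinite_submod.

Record dsum := DSum { dcoef : dprod; dcoefP : dcoef \in dfinite }.
HB.instance Definition _ := [isSub for dcoef].
HB.instance Definition _ := [Choice of dsum by <:].
HB.instance Definition _ := [SubChoice_isSubZmodule of dsum by <:].
HB.instance Definition _ := [SubZmodule_isSubLmodule of dsum by <:].

Lemma dinjP i (x : Q i) : (dfwith dprod0 x : dprod) \in dfinite.
Proof.
apply/dfiniteP; apply: (@sub_finite_set _ _ [set i]); last exact: finite_set1.
move=> j /=; case: dfwithP => // j' _; first by rewrite eqxx.
Qed.
Definition dinj i (x : Q i) : dsum := DSum (dinjP x).
End DirectSum.

Local Notation "x %:F" := (@FracField.tofrac _ x) (format "x %:F").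

(* R[[x_1,...,x_n]] is psn n R = R[[x_1]]...[[x_n]], and U((x_1))...((x_n)) is *)
(* iterL n U (iterK n K for a field K of coefficients).  In all three the last *)
(* variable x_n is the outermost one.  The variable x_j has index i = j - 1.   *)
Fixpoint psn (n : nat) (R : idomainType) : idomainType :=
  if n is m.+1 then pseries (psn m R) else R.
Fixpoint iterL (R : pzRingType) (n : nat) (U : lmodType R) : lmodType R :=
  if n is m.+1 then laurent (iterL m U) else U.
Fixpoint iterK (n : nat) (K : fieldType) : fieldType :=
  if n is m.+1 then laurent (iterK m K) else K.

Fixpoint psnC (R : idomainType) (n : nat) : R -> psn n R :=
  if n is m.+1 then fun c => psC (psnC m c) else fun c => c.

Fixpoint is_mpoly (R : idomainType) (n : nat) : psn n R -> Prop :=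
  if n is m.+1 then fun f : pseries (psn m R) =>
    (exists N, forall k, (N <= k)%N -> f k = 0) /\ forall k, is_mpoly (f k)
  else fun=> True.

Fixpoint pderiv (R : idomainType) (n i : nat) : psn n R -> psn n R :=
  if n is m.+1 then fun f : pseries (psn m R) =>
    if i == m then fun k => f k.+1 *+ k.+1 else fun k => pderiv i (f k)
  else fun=> 0.

(* g(x_{i+1})                                                                  *)
Fixpoint psub (R : idomainType) (n i : nat) (g : pseries R) : psn n R :=
  if n is m.+1 then
    if i == m then (fun k => psnC m (g k)) : pseries _ else psC (psub m i g)
  else 0.

(* ptr g = g_0 + g_1 t + g_2 t^2 + ... in R[[t]][[x_1]]...[[x_n]]              *)
Fixpoint ptr (R : idomainType) (n : nat) : (nat -> psn n R) -> psn n (pseries R) :=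
  if n is m.+1 then fun g => (fun k => ptr (fun j => g j k)) : pseries _
  else fun g => g.

(* f(t+x_1,...,t+x_n) = e^{t(d/dx_1+...+d/dx_n)} f                             *)
Definition pshift (F : fieldType) (n : nat) (f : psn n F) : psn n (pseries F) :=
  ptr (fun k => psnC n (k`!%:R)^-1 * iter k (fun g => \sum_(i < n) pderiv i g) f).

(* The map R[[x_1,...,x_n]] -> K((x_1))...((x_n)) given by phi on coefficients *)
Fixpoint psiota (R : idomainType) (K : fieldType) (phi : R -> K) (n : nat) :
    psn n R -> iterK n K :=
  if n is m.+1 then fun f : pseries (psn m R) => lps (fun k => psiota phi (f k))
  else phi.

(* The extension to fractions of an injective ring morphism phi; it does not   *)
(* depend on the representative of the fraction (frac_extE).                   *)
Definition frac_ext (R : idomainType) (K : fieldType) (phi : R -> K)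
    (x : {fraction R}) : K :=
  phi (\n_(repr x))%qT / phi (\d_(repr x))%qT.

Lemma frac_numden (R : idomainType) (x : {fraction R}) :
  x = (\n_(repr x))%qT%:F / (\d_(repr x))%qT%:F.
Proof.
apply: (canRL (mulfK _)); first by rewrite tofrac_eq0 denom_ratioP.
have e : x = (\pi_({fraction R}) (repr x))%qT by rewrite reprK.
rewrite {1}e; set r := repr x.
unlock FracField.tofrac; rewrite -[LHS]FracField.pi_mul.
apply/eqmodP; rewrite /= FracField.equivfE /FracField.mulf !numden_Ratio ?oner_neq0 ?mulr1 ?denom_ratioP//.
by rewrite mulrC.
Qed.

Lemma frac_extE (R : idomainType) (K : fieldType) (phi : {rmorphism R -> K}) (a b : R) :
  injective phi -> b != 0 -> frac_ext phi (a%:F / b%:F) = phi a / phi b.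
Proof.
move=> inj b0; rewrite /frac_ext; set r := repr _.
have d0 : \d_r != 0 := denom_ratioP r.
have phi0 c : c != 0 -> phi c != 0 by rewrite -(rmorph0 phi) (inj_eq inj).
apply/eqP; rewrite eqr_div ?phi0// -!rmorphM (inj_eq inj) -tofrac_eq !tofracM.
by rewrite -eqr_div ?tofrac_eq0// [eqbRHS]frac_numden.
Qed.

(* pshift is an injective ring morphism, which sends nonzero polynomials in    *)
(* x_1,...,x_n to nonzero polynomials in t,x_1,...,x_n; on F_*(x_1,...,x_n)    *)
(* this is f(t+x_1,...,t+x_n), with values in F_*(t,x_1,...,x_n).              *)
Definition fshift (F : fieldType) (n : nat) (x : {fraction psn n F}) :
    {fraction psn n (pseries F)} :=
  frac_ext (fun f => (pshift f)%:F) x.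

Section MPoly.
Variable R : idomainType.

Lemma psnC0 n : psnC n (0 : R) = 0.
Proof.
elim: n => //= n ->; apply/funext => k; rewrite /psC; by case: eqP.
Qed.

Lemma psnC1 n : psnC n (1 : R) = 1.
Proof. by elim: n => //= n ->. Qed.

Lemma is_mpoly0 n : is_mpoly (0 : psn n R).
Proof. by elim: n => //= n IH; split=> // ; exists 0%N. Qed.

Lemma is_mpolyC n (c : R) : is_mpoly (psnC n c).
Proof.
elim: n => //= n IH; split=> [|k]; first by exists 1%N => -[].
by rewrite /psC; case: eqP => // _; apply: is_mpoly0.
Qed.

Lemma is_mpolyD n (f g : psn n R) : is_mpoly f -> is_mpoly g -> is_mpoly (f + g).
Proof.
elim: n f g => //= n IH f g [[M fM] fp] [[N gN] gp]; split=> [|k]; last exact: IH.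
exists (M + N)%N => k MNk; transitivity (f k + g k) => //.
by rewrite fM ?gN ?addr0//; lia.
Qed.

Lemma is_mpolyN n (f : psn n R) : is_mpoly f -> is_mpoly (- f).
Proof.
elim: n f => //= n IH f [[M fM] fp]; split=> [|k]; last exact: IH.
by exists M => k Mk; transitivity (- f k) => //; rewrite fM ?oppr0.
Qed.

Lemma is_mpolyM n (f g : psn n R) : is_mpoly f -> is_mpoly g -> is_mpoly (f * g).
Proof.
elim: n f g => //= n IH f g [[M fM] fp] [[N gN] gp]; split=> [|k].
  exists (M + N)%N => k MNk; rewrite ps_coefM big1// => i _.
  have [Mi|iM] := leqP M i; first by rewrite fM ?mul0r.
  by rewrite gN ?mulr0//; lia.
rewrite ps_coefM; elim/big_ind: _ => [|x y|i _]; first exact: is_mpoly0.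
  exact: is_mpolyD.
exact: IH.
Qed.

Lemma is_mpolyX n (f : psn n R) k : is_mpoly f -> is_mpoly (f ^+ k).
Proof.
move=> fp; elim: k => [|k IH]; last by rewrite exprS; apply: is_mpolyM.
by rewrite expr0 -psnC1; apply: is_mpolyC.
Qed.

Definition psX : pseries R := fun k => (k == 1%N)%:R.

Lemma psub_mpoly n i : is_mpoly (psub n i psX).
Proof.
elim: n => //= n IH; case: eqP => _; split.
- exists 2%N => -[|[|k]]// _; exact: psnC0.
- by move=> k; apply: is_mpolyC.
- by exists 1%N => -[].
- by move=> k; rewrite /psC; case: eqP => // _; apply: is_mpoly0.
Qed.

Lemma psub_neq0 n i : (i < n)%N -> psub n i psX != 0.
Proof.
elim: n => //= n IH; rewrite ltnS leq_eqVlt; case: eqP => [_ _|_ /= /IH h].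
  apply/eqP => /(congr1 (fun f : pseries (psn n R) => f 1%N))/eqP.
  by rewrite /psX eqxx psnC1 [X in _ == X]/(0 : psn n R) oner_eq0.
apply: contraNneq h => /(congr1 (fun f : pseries (psn n R) => f 0%N)) h.
exact/eqP.
Qed.
End MPoly.

Section FStar.
Variables (F : fieldType) (n : nat).

(* F_*(x_1,...,x_n), as the ring of the fractions of F[[x_1,...,x_n]] whose    *)
(* denominator is a nonzero polynomial.                                        *)
Definition is_fstar : {pred {fraction psn n F}} :=
  fun x => `[< exists f p, [/\ is_mpoly p, p != 0 & x = f%:F / p%:F] >].

Lemma is_fstarP x :
  reflect (exists f p, [/\ is_mpoly p, p != 0 & x = f%:F / p%:F]) (x \in is_fstar).
Proof. by rewrite unfold_in; apply: asboolP. Qed.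

Lemma is_fstar_subring : subring_closed is_fstar.
Proof.
split=> [|x y /is_fstarP[f [p [pp p0 ->]]] /is_fstarP[g [q [qp q0 ->]]]
  |x y /is_fstarP[f [p [pp p0 ->]]] /is_fstarP[g [q [qp q0 ->]]]]; apply/is_fstarP.
- exists 1, 1; rewrite oner_neq0 divff ?tofrac_eq0 ?oner_neq0//.
  by split=> //; rewrite -psnC1; apply: is_mpolyC.
- exists (f * q - g * p), (p * q); rewrite mulf_neq0//; split=> //.
    exact: is_mpolyM.
  by rewrite -mulNr addf_div ?tofrac_eq0// tofracB !tofracM mulNr.
- exists (f * g), (p * q); rewrite mulf_neq0//; split=> //.
    exact: is_mpolyM.
  by rewrite mulf_div !tofracM.
Qed.
HB.instance Definition _ :=
  GRing.isSubringClosed.Build {fraction psn n F} is_fstar is_fstar_subring.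

Record fstar := FStar { fstar_val : {fraction psn n F}; fstarP : fstar_val \in is_fstar }.
HB.instance Definition _ := [isSub for fstar_val].
HB.instance Definition _ := [Choice of fstar by <:].
HB.instance Definition _ := [SubChoice_isSubComNzRing of fstar by <:].

Lemma fstarCP c : (psnC n c)%:F \in is_fstar.
Proof.
apply/is_fstarP; exists (psnC n c), 1; rewrite oner_neq0 tofrac1 divr1.
by split=> //; rewrite -psnC1; apply: is_mpolyC.
Qed.
Definition fstarC c : fstar := FStar (fstarCP c).

(* f(x_{i+1}) = g(x_{i+1}) / x_{i+1}^N, where f(t) = t^{-N} g(t) with g in     *)
(* F[[t]] and N = lbound f.                                                    *)
Lemma lbound_ex (f : laurent F) : exists N : nat, forall k : int, k < - N%:Z -> f k = 0.
Proof.
have /lower_truncatedP[M fM] := lcoefP f; exists `|M|%N => k kM.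
by rewrite fM//; lia.
Qed.
Definition lbound f : nat := projT1 (cid (lbound_ex f)).

Lemma fstar_subP (i : 'I_n) (f : laurent F) :
  (psub n i (fun k => f (k%:Z - (lbound f)%:Z)))%:F / (psub n i (psX F))%:F ^+ lbound f
    \in is_fstar.
Proof.
apply/is_fstarP; rewrite -tofracXn; eexists _, _; split; last reflexivity.
  exact/is_mpolyX/psub_mpoly.
by rewrite expf_neq0// psub_neq0.
Qed.
Definition fstar_sub i f : fstar := FStar (fstar_subP i f).
End FStar.

Section LaurentCalculus.
Variable F : fieldType.

Definition lderiv (f : laurent F) : laurent F := lof (fun m => f (m + 1) *~ (m + 1)).

(* f(t+x) = e^{x d/dt} f(t) in F((t))((x))                                     *)
Definition ltaylor (f : laurent F) : laurent (laurent F) :=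
  lps (fun k => lconst (k`!%:R)^-1 * iter k lderiv f).

(* The binomial coefficient p(p-1)...(p-j+1)/j!                                *)
Definition binomF (p : int) (j : nat) : F :=
  (\prod_(i < j) (p%:~R - i%:R)) / j`!%:R.
End LaurentCalculus.

(* The data of a nonlocal vertex F((t))-algebra; vY v w = Y(v,x)w, and         *)
(* tact f v = f(t)v.  The axioms are in is_nonlocal_tva.                       *)
Record vdata (F : fieldType) := VData {
  vsort :> lmodType F;
  vY : vsort -> vsort -> laurent vsort;
  vac : vsort;
  tact : laurent F -> vsort -> vsort }.
Arguments vac {F v}.
Arguments tact {F v}.

Section VertexAlgebra.
Variables (F : fieldType) (V : vdata F).

(* v_n w                                                                       *)
Definition mode (v : V) (n : int) (w : V) : V := vY v w (- n - 1).

(* Coefficients of x0^a x2^b in Y(u,x0+x2)Y(v,x2)w and Y(Y(u,x0)v,x2)w, where  *)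
(* (x0+x2)^p = \sum_(j >= 0) 'C(p,j) x0^(p-j) x2^j; the sum over j is finite.  *)
Definition assocl (u v w : V) (a b : int) : V :=
  \sum_(j \in [set: nat])
    binomF F (a + j%:Z) j *: vY u (vY v w (b - j%:Z)) (a + j%:Z).
Definition assocr (u v w : V) (a b : int) : V := vY (vY u v a) w b.
(* (x0+x2) f(x0,x2)                                                            *)
Definition mulx0x2 (f : int -> int -> V) (a b : int) : V := f (a - 1) b + f a (b - 1).

Record is_nonlocal_va : Prop := {
  vY_linearl : forall w, linear (fun v : V => vY v w);
  vY_linearr : forall v : V, linear (vY v);
  vY_vac : forall v : V, vY vac v = lconst v;
  vY_creation : forall (v : V) n, n < 0 -> vY v vac n = 0;
  vY_creation0 : forall v : V, vY v vac 0 = v;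
  vY_assoc : forall u v w : V, exists l,
    iter l mulx0x2 (assocl u v w) = iter l mulx0x2 (assocr u v w) }.

Record is_tmodule : Prop := {
  tact_linear : forall f, linear (tact f : V -> V);
  tactDl : forall f g (v : V), tact (f + g) v = tact f v + tact g v;
  tactM : forall f g (v : V), tact (f * g) v = tact f (tact g v);
  tactC : forall c (v : V), tact (lconst c) v = c *: v }.

Record is_nonlocal_tva : Prop := {
  tva_va :> is_nonlocal_va;
  tva_tmod :> is_tmodule;
  vY_tact : forall f g (u v : V),
    vY (tact f u) (tact g v) = lconv tact (ltaylor f * lconst g) (vY u v) }.

Definition is_irreducible : Prop :=
  (exists v : V, v <> 0) /\
  forall S : set V, is_submod S -> (forall v n w, S w -> S (mode v n w)) ->
    S = [set 0] \/ S = setT.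

Definition End_eq_t : Prop :=
  forall psi : {linear V -> V},
    (forall v n w, psi (mode v n w) = mode v n (psi w)) ->
    exists f, forall w, psi w = tact f w.

(* Y(v_1,x_1)...Y(v_n,x_n)w                                                    *)
Fixpoint Yprod (n : nat) : ('I_n -> V) -> V -> iterL n V :=
  if n is m.+1 then fun v w =>
    lmap (Yprod (fun i => v (widen_ord (leqnSn m) i))) (vY (v ord_max) w)
  else fun _ w => w.

(* The action of F((t))((x_1))...((x_n)) on V((x_1))...((x_n))                 *)
Fixpoint iter_tact (n : nat) : iterK n (laurent F) -> iterL n V -> iterL n V :=
  if n is m.+1 then lconv (@iter_tact m) else (tact : laurent F -> V -> V).

Section Box.
Variable n : nat.

(* tens is the tensor product over F of n copies of V and of F_*(x_1,...,x_n). *)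
Definition tgen : choiceType := (('I_n -> V) * fstar F n)%type.
Definition tgenerator (v : 'I_n -> V) (f : fstar F n) : {malg F[tgen]} := << (v, f) : tgen >>.
Definition vupd (v : 'I_n -> V) (i : 'I_n) (x : V) : 'I_n -> V :=
  fun j => if j == i then x else v j.
Definition tens_rel : set {malg F[tgen]} :=
  [set z | exists v i c x y f,
     z = tgenerator (vupd v i (c *: x + y)) f
         - (c *: tgenerator (vupd v i x) f + tgenerator (vupd v i y) f)]
  `|` [set z | exists v c f g,
     z = tgenerator v (fstarC n c * f + g) - (c *: tgenerator v f + tgenerator v g)].
Definition tens : lmodType F := lquot tens_rel.
Definition tpure v f : tens := lpi tens_rel (tgenerator v f).

(* box is V^{\otimes n} \boxtimes F_*(x_1,...,x_n)                             *)
Definition box_rel : set tens :=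
  [set z | exists (h : 'I_n -> laurent F) v f,
     z = tpure (fun i => tact (h i) (v i)) f
         - tpure v ((\prod_i fstar_sub i (h i)) * f)].
Definition box : lmodType F := lquot box_rel.
Definition boxpure v f : box := lpi box_rel (tpure v f).

(* \iota_{t,x_1,...,x_n} f(t+x_1,...,t+x_n)                                    *)
Definition iota_shift (f : fstar F n) : iterK n (laurent F) :=
  frac_ext (psiota (@lps F) (n := n)) (fshift (val f)).

End Box.

Definition is_nondegenerate : Prop :=
  forall n, (0 < n)%N ->
  exists Z : {linear box n -> iterL n V},
    (forall v f, Z (boxpure v f) = iter_tact (iota_shift f) (Yprod v vac)) /\
    injective Z.
End VertexAlgebra.

(* Filtrations are indexed by half-integers: Fil p stands for F_{p/2}.         *)
Section Gr.
Variables (F : fieldType) (V : vdata F) (Fil : int -> submod V).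

Record is_filtration : Prop := {
  fil_tact : forall p f u, Fil p u -> Fil p (tact f u);
  fil_mono : forall p q, p <= q -> forall v, Fil p v -> Fil q v;
  fil_union : forall v, exists p, Fil p v;
  fil_bounded : exists N, forall p, p < N -> forall v, Fil p v -> v = 0;
  fil_vac : Fil 0 vac;
  fil_mode : forall m n k u w, Fil m u -> Fil n w ->
    Fil (m + n - 2 * k - 2) (mode u k w) }.

Definition gr_piece (p : int) : lmodType F :=
  lquot [set x : subl (Fil p) | Fil (p - 1) (val x)].
Definition gr : lmodType F := dsum gr_piece.

(* The class of v in the summand F_{p/2} / F_{(p-1)/2}, for v in Fil p.        *)
Definition gr_in (p : int) (v : V) : gr :=
  dinj (lpi _ (insubd 0 v : subl (Fil p)) : gr_piece p).
Definition gr_repr (a : gr) (p : int) : V := val (lrepr (dcoef a p)).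

(* The bilinear extension of                                                   *)
(*   (u + F_{m-1/2})_k (w + F_{n-1/2}) = u_k w + F_{m+n-k-3/2},                *)
(* computed on representatives of the components (see Gr_modeE).               *)
Definition gr_mode (a : gr) (k : int) (b : gr) : gr :=
  \sum_(m \in [set: int]) \sum_(n \in [set: int])
    gr_in (m + n - 2 * k - 2) (mode (gr_repr a m) k (gr_repr b n)).
Definition gr_tact (f : laurent F) (a : gr) : gr :=
  \sum_(m \in [set: int]) gr_in m (tact f (gr_repr a m)).

Definition Gr : vdata F := VData
  (fun a b => lof (fun e => gr_mode a (- e - 1) b)) (gr_in 0 vac) gr_tact.

Lemma gr_lpiE p (x y : subl (Fil p)) :
  (lpi [set x : subl (Fil p) | Fil (p - 1) (val x)] x = lpi _ y) <->
  Fil (p - 1) (val x - val y).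
Proof.
have [S0 SD SZ] := ssetP (Fil (p - 1)).
rewrite lpi_eqE -raddfB; split=> [/lspanP h|xy].
  apply: (h [set x | Fil (p - 1) (val x)]) => //.
  by split=> [|a b|c a] /=; rewrite ?raddf0// ?raddfD ?linearZ/=; auto.
by apply/lspanP => S _; apply.
Qed.

Hypothesis VP : is_nonlocal_tva V.
Hypothesis FP : is_filtration.

Let valK p v : Fil p v -> val (insubd 0 v : subl (Fil p)) = v.
Proof. by move=> /sub_predP pv; rewrite insubdK. Qed.

Lemma gr_in_eq p v w : Fil p v -> Fil p w -> Fil (p - 1) (v - w) -> gr_in p v = gr_in p w.
Proof.
move=> pv pw vw; rewrite /gr_in; congr dinj; apply/gr_lpiE.
by rewrite !valK.
Qed.

Lemma gr_in0 p : gr_in p 0 = 0.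
Proof.
apply/val_inj/functional_extensionality_dep => q.
rewrite /gr_in /= (_ : insubd _ _ = 0); last first.
  by apply/val_inj; rewrite valK ?raddf0//; exact: submod0 (ssetP _).
by rewrite raddf0; case: dfwithP.
Qed.

Let fil_lt p v : Fil (p - 1) v -> Fil p v.
Proof. by apply: fil_mono; rewrite // lerBlDr lerDl. Qed.

Lemma gr_in_lower p v : Fil (p - 1) v -> gr_in p v = 0.
Proof.
move=> pv; rewrite -(gr_in0 p); apply: gr_in_eq; rewrite ?subr0//.
  exact: fil_lt.
exact: submod0 (ssetP _).
Qed.

Lemma gr_repr_fil (a : gr) p : Fil p (gr_repr a p).
Proof. exact/sub_predP/sublP. Qed.

Lemma gr_repr_in p v : Fil p v -> Fil (p - 1) (gr_repr (gr_in p v) p - v).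
Proof.
move=> pv.
suff: Fil (p - 1) (gr_repr (gr_in p v) p - val (insubd 0 v : subl (Fil p))).
  by rewrite valK.
by apply/gr_lpiE; rewrite lreprK /gr_in /= dfwith_in.
Qed.

Lemma gr_repr_out p q v : q != p -> Fil (q - 1) (gr_repr (gr_in p v) q).
Proof.
move=> qp; 
suff: Fil (q - 1) (gr_repr (gr_in p v) q - val (0 : subl (Fil q))).
  have -> : val (0 : subl (Fil q)) = 0 :> V by exact: raddf0.
  by rewrite subr0.
by apply/gr_lpiE; rewrite lreprK raddf0 /gr_in /= dfwith_out// eq_sym.
Qed.

Let modeBl (u v w : V) k : mode (u - v) k w = mode u k w - mode v k w.
Proof.
have e := vY_linearl VP w (-1) v u.
rewrite /mode [u - v]addrC -scaleN1r e scaleN1r.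
by rewrite [LHS]/(- _ + _) addrC.
Qed.

Let modeBr (u v w : V) k : mode u k (v - w) = mode u k v - mode u k w.
Proof.
have e := vY_linearr VP u (-1) w v.
rewrite /mode [v - w]addrC -scaleN1r e scaleN1r.
by rewrite [LHS]/(- _ + _) addrC.
Qed.

Let sum_int1 (f : int -> gr) m : (forall p, p != m -> f p = 0) ->
  \sum_(p \in [set: int]) f p = f m.
Proof.
move=> fm; rewrite -(@fsbig_widen _ _ _ _ [set m])// ?fsbig_set1// => p [_ /= /eqP pm].
exact: fm.
Qed.

Lemma gr_mode_in m n k u w : Fil m u -> Fil n w ->
  gr_mode (gr_in m u) k (gr_in n w) = gr_in (m + n - 2 * k - 2) (mode u k w).
Proof.
move=> mu nw; rewrite /gr_mode (@sum_int1 _ m); last first.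
  move=> p pm; rewrite fsbig1// => q _; apply: gr_in_lower.
  have := fil_mode FP k (gr_repr_out _ pm) (gr_repr_fil (gr_in n w) q) (u := gr_repr (gr_in m u) p).
  by congr (Fil _ _); lia.
rewrite (@sum_int1 _ n); last first.
  move=> q qn; apply: gr_in_lower.
  have := fil_mode FP k (gr_repr_fil (gr_in m u) m) (gr_repr_out w qn).
  by congr (Fil _ _); lia.
apply: gr_in_eq; [by apply: fil_mode => //; exact: gr_repr_fil|exact: fil_mode|].
set u' := gr_repr _ m; set w' := gr_repr _ n.
have -> : mode u' k w' - mode u k w = mode (u' - u) k w' + mode u k (w' - w).
  by rewrite modeBl modeBr addrA subrK.
apply: submodD (ssetP _) _ _ _ _.
  have := fil_mode FP k (gr_repr_in mu) (gr_repr_fil (gr_in n w) n).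
  by congr (Fil _ _); lia.
have := fil_mode FP k mu (gr_repr_in nw).
by congr (Fil _ _); lia.
Qed.

Lemma Gr_modeE m n k u w : Fil m u -> Fil n w ->
  mode (gr_in m u : Gr) k (gr_in n w : Gr) = gr_in (m + n - 2 * k - 2) (mode u k w).
Proof.
move=> mu nw; have [N vN] := lower_truncatedP _ (lcoefP (vY u w)).
rewrite /mode /= (@lofE _ _ N) => [|e eN].
  by rewrite (_ : - (- k - 1) - 1 = k) ?gr_mode_in//; lia.
rewrite gr_mode_in// /mode (_ : - (- e - 1) - 1 = e); last by lia.
by rewrite vN// gr_in0.
Qed.

Lemma Gr_tactE m f u : Fil m u -> tact f (gr_in m u : Gr) = gr_in m (tact f u).
Proof.
have tact0 : forall p v, Fil p v -> Fil p (tact f v) by move=> p v; exact: fil_tact.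
move=> mu; rewrite /tact /= /gr_tact (@sum_int1 _ m).
  apply: gr_in_eq; [by apply: tact0; exact: gr_repr_fil|exact: tact0|].
  have e := tact_linear VP f (-1) u (gr_repr (gr_in m u) m).
  have -> : tact f (gr_repr (gr_in m u) m) - tact f u
      = tact f (gr_repr (gr_in m u) m - u).
    rewrite [RHS](_ : _ = tact f (-1 *: u + gr_repr (gr_in m u) m)).
      by rewrite e scaleN1r addrC.
    by rewrite scaleN1r addrC.
  exact/tact0/gr_repr_in.
by move=> p pm; apply/gr_in_lower/tact0/gr_repr_out.
Qed.
End Gr.

(* Main.v *)
(* Irreducibility and the commutant pass from Gr(V) to V by leading terms: a
   submodule of V is determined by its associated graded submodule, because the
   filtration is bounded below, and an endomorphism psi of V with psi(1) in F_p
   induces an endomorphism of Gr(V) of degree p, which is multiplication by some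
   f(t); so either psi(1) lies in F_{p-1/2}, or p = 0 and psi - f lowers the
   filtration, and one descends on p.

   Non-degeneracy only uses that V is irreducible with commutant F((t)). By weak
   associativity the kernel of Z_n is stable under the modes acting on the slot k,
   provided that the slots before k contain the vacuum. Write an element of the
   kernel as a sum of e_i (in slot k) times X_i (vacuum in slot k). Either some e_i
   is an F((t))-combination of the others and is eliminated through the relations of
   the box product, or by Jacobson density an operator generated by the modes maps
   it to the vacuum and kills the others, which puts X_i in the kernel. By
   induction on the slots it remains to treat 1 x ... x 1 box f, whose image
   f(t+x_1,...,t+x_n) 1 vanishes only if f = 0. *)
From HB Require Import structures.
Require Import Defs.
From mathcomp Require Import all_boot all_order all_algebra.
From mathcomp Require Import boolp classical_sets functions cardinality fsbigop.
From mathcomp Require Import zify.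
From mathcomp Require Import finmap.
From mathcomp.multinomials Require Import monalg.

Set Implicit Arguments.
Unset Strict Implicit.
Unset Printing Implicit Defensive.

Import Order.TTheory GRing.Theory Num.Theory.
Local Open Scope classical_set_scope.
Local Open Scope ring_scope.

(** * Laurent series with coefficients in a module *)

(** The obstacle in non-degeneracy is that the box product is a quotient without a usable basis, so
    linear independence cannot be read off an element. Density replaces it, and each operation on an
    element is a linear map given by the universal property [box_lift]. Such a map on slot k must
    commute with F((t)). Modes do, because Y translates only the scalars of its left argument: there
    f(t) becomes f(t+x), while scalars of the right argument stay f(t). The vacuum before slot k
    makes Y(v_k,x_k) the leftmost operator that is not the identity, so Y(u,y) can be applied to a
    relation from the left. Weak associativity then moves u into slot k after multiplication by a
    power of x_0+x_2, and this power cancels because the series involved are bounded below in x_0.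
    That Z_n respects the box relations rests on one symmetry: for a power series g, translating
    g(x) by t and expanding g(t+x) in powers of x both give the coefficient binom(m+k,k) g_{m+k} at
    t^m x^k. *)

Lemma fsbigT1 (T : choiceType) (M : zmodType) (f : T -> M) (x : T) :
  (forall y, y != x -> f y = 0) -> \sum_(y \in [set: T]) f y = f x.
Proof.
move=> fx; rewrite -(@fsbig_widen _ _ _ _ [set x])// ?fsbig_set1// => y [_ /= /eqP yx].
exact: fx.
Qed.

Section LaurentCoef.
Variables U W : zmodType.

Lemma lcoefD (f g : laurent U) n : (f + g) n = f n + g n.
Proof. by []. Qed.

Lemma lcoef0 n : (0 : laurent U) n = 0.
Proof. by []. Qed.

Lemma lcoef_sum (I : Type) (r : seq I) (P : pred I) (f : I -> laurent U) n :
  (\sum_(i <- r | P i) f i) n = \sum_(i <- r | P i) f i n.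
Proof. exact: (big_morph (fun g : laurent U => g n)). Qed.

Lemma lmapE (phi : U -> W) (f : laurent U) n : phi 0 = 0 -> lmap phi f n = phi (f n).
Proof.
move=> phi0; have [N fN] := lower_truncatedP _ (lcoefP f).
by rewrite /lmap (@lofE _ _ N)// => m mN; rewrite fN.
Qed.
End LaurentCoef.

Lemma lcoefZ (R : pzRingType) (U : lmodType R) c (f : laurent U) n :
  (c *: f) n = c *: f n.
Proof. by []. Qed.

Definition biadditive (A B C : zmodType) (op : A -> B -> C) :=
  (forall a b y, op (a + b) y = op a y + op b y) /\
  (forall a x y, op a (x + y) = op a x + op a y).

Section Biadditive.
Variables (A B C : zmodType) (op : A -> B -> C).
Hypothesis opD : biadditive op.

Lemma biadd0l b : op 0 b = 0.
Proof. by apply: (addrI (op 0 b)); rewrite -(proj1 opD) !addr0. Qed.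

Lemma biadd0r a : op a 0 = 0.
Proof. by apply: (addrI (op a 0)); rewrite -(proj2 opD) !addr0. Qed.

Lemma biadd_suml (I : Type) (r : seq I) (f : I -> A) b :
  op (\sum_(i <- r) f i) b = \sum_(i <- r) op (f i) b.
Proof. exact: (big_morph (op^~ b) (fun x y => proj1 opD x y b) (biadd0l b)). Qed.

Lemma biadd_sumr (I : Type) (r : seq I) (f : I -> B) a :
  op a (\sum_(i <- r) f i) = \sum_(i <- r) op a (f i).
Proof. exact: (big_morph (op a) (proj2 opD a) (biadd0r a)). Qed.

(** The terms of a convolution with index in [-L, L). The support of a convolution depends on both
    factors; a window indexed by an ordinal lets several convolutions share one large L, which
    reduces their identities to finite sums. *)
Definition wsum (L : nat) (f : int -> A) (g : int -> B) n : C :=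
  \sum_(k < L.*2) op (f (k%:Z - L%:Z)) (g (n - (k%:Z - L%:Z))).

Lemma lconv_wsum f g n : exists L0, forall L, (L0 <= L)%N ->
  lconv op f g n = wsum L f g n.
Proof.
have [M fM] := lower_truncatedP _ (lcoefP f).
have [N gN] := lower_truncatedP _ (lcoefP g).
exists (`|M| + `|n - N|).+1%N => L L0L.
rewrite lconvE; [|exact: biadd0l|exact: biadd0r].
pose h (j : nat) : int := j%:Z - L%:Z.
rewrite -(@fsbig_widen _ _ _ _ (h @` `I_(L.*2)))//; last first.
  move=> i [_ /= hi]; have [iM|Mi] := ltP i M; first by rewrite fM ?biadd0l.
  have [iN|Ni] := ltP (n - i) N; first by rewrite gN ?biadd0r.
  by case: hi; exists (absz (i + L%:Z)); rewrite /h /=; lia.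
rewrite fsbig_image; last by move=> i j _ _; rewrite /h; lia.
by rewrite -fsbig_ord.
Qed.

Lemma lconv_biadditive : biadditive (lconv op).
Proof.
split=> [f g y|f x y]; apply: laurentP => n; rewrite lcoefD.
  have [L1 h1] := lconv_wsum (f + g) y n; have [L2 h2] := lconv_wsum f y n.
  have [L3 h3] := lconv_wsum g y n.
  rewrite (h1 (L1 + L2 + L3)%N) ?(h2 (L1 + L2 + L3)%N) ?(h3 (L1 + L2 + L3)%N); try lia.
  by rewrite -big_split; apply: eq_bigr => i _; rewrite lcoefD (proj1 opD).
have [L1 h1] := lconv_wsum f (x + y) n; have [L2 h2] := lconv_wsum f x n.
have [L3 h3] := lconv_wsum f y n.
rewrite (h1 (L1 + L2 + L3)%N) ?(h2 (L1 + L2 + L3)%N) ?(h3 (L1 + L2 + L3)%N); try lia.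
by rewrite -big_split; apply: eq_bigr => i _; rewrite lcoefD (proj2 opD).
Qed.

Lemma lconv_lconstl a g n : lconv op (lconst a) g n = op a (g n).
Proof.
rewrite lconvE; [|exact: biadd0l|exact: biadd0r].
rewrite (fsbigT1 (x := 0)) ?lconstE ?eqxx ?subr0// => y /negbTE y0.
by rewrite lconstE y0 biadd0l.
Qed.

Lemma lconv_lconstr f b n : lconv op f (lconst b) n = op (f n) b.
Proof.
rewrite lconvE; [|exact: biadd0l|exact: biadd0r].
rewrite (fsbigT1 (x := n)) ?lconstE ?subrr ?eqxx// => y /negbTE y0.
by rewrite lconstE subr_eq0 eq_sym y0 biadd0r.
Qed.
End Biadditive.

(** Both sides run over the triples of sum n, sorted on the left by the first entry and on the right
    by the sum of the first two. This is the associativity of Cauchy products for an arbitrary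
    operation. *)
Lemma sum_triangle (M : zmodType) (f : nat -> nat -> nat -> M) n :
  \sum_(i < n.+1) \sum_(j < (n - i).+1) f i j (n - i - j)%N =
  \sum_(i < n.+1) \sum_(j < i.+1) f j (i - j)%N (n - i)%N.
Proof.
pose T := \sum_(i < n.+1) \sum_(j < n.+1 | (i <= j)%N) f i (j - i)%N (n - j)%N.
transitivity T.
  apply: eq_bigr => i _; have iN : (i <= n)%N by rewrite -ltnS.
  rewrite -(big_mkord xpredT (fun j => f i j (n - i - j)%N)) -subSn//.
  rewrite -(big_mkord (fun j => i <= j)%N (fun j => f i (j - i)%N (n - j)%N)).
  rewrite [RHS](big_cat_nat (n := i))//=; last exact: leqW.
  rewrite [X in _ = X + _]big_nat_cond [X in _ = X + _]big1 ?add0r; last first.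
    by move=> j H; exfalso; lia.
  have := big_addn 0 n.+1 i (fun j => i <= j)%N (fun j => f i (j - i)%N (n - j)%N).
  rewrite add0n => ->; rewrite [LHS]big_nat_cond [RHS]big_nat_cond.
  by apply: eq_big => j /=; [lia|move=> jn; congr f; lia].
rewrite /T (exchange_big_dep xpredT)//=; apply: eq_bigr => i _.
rewrite -(big_mkord (fun j => j <= i)%N (fun j => f j (i - j)%N (n - i)%N)).
rewrite (big_cat_nat (n := i.+1))//= addrC big_nat_cond big1 ?add0r; last by move=> j H; exfalso; lia.
rewrite -(big_mkord xpredT (fun j => f j (i - j)%N (n - i)%N)).
by rewrite big_nat_cond [RHS]big_nat_cond; apply: eq_bigl => j; lia.
Qed.

Section LaurentAction.
Variables (K : fieldType) (M : zmodType) (op : K -> M -> M).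
Hypothesis opD : biadditive op.
Hypothesis opM : forall a b y, op (a * b) y = op a (op b y).

Let op0l := biadd0l opD.
Let op0r := biadd0r opD.

Lemma lconv_act f g y : lconv op (f * g) y = lconv op f (lconv op g y).
Proof.
elim/lpow_ind: f => a p; elim/lpow_ind: g => b q.
have [N /(_ N (lexx N))[r ->]] := lpow_surj y.
rewrite lpowM !(lconv_pow op0l op0r) addrA; congr lpow; apply/funext => n.
transitivity (\sum_(i < n.+1) \sum_(j < i.+1) op (p j) (op (q (i - j)%N) (r (n - i)%N))).
  apply: eq_bigr => i _; rewrite ps_coefM biadd_suml//.
  by apply: eq_bigr => j _; rewrite opM.
rewrite -(sum_triangle (fun i j k => op (p i) (op (q j) (r k)))).
by apply: eq_bigr => i _; rewrite biadd_sumr.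
Qed.

End LaurentAction.

Fixpoint kconst (K : fieldType) (n : nat) : K -> iterK n K :=
  if n is m.+1 then fun c => lconst (kconst m c) else fun c => c.

Lemma lconstD (U : zmodType) (a b : U) : lconst (a + b) = lconst a + lconst b.
Proof.
apply: laurentP => n; rewrite lcoefD !lconstE.
by case: eqP => _; rewrite ?addr0.
Qed.

Lemma lconst0 (U : zmodType) : lconst (0 : U) = 0.
Proof. by apply: (addrI (lconst 0)); rewrite -lconstD !addr0. Qed.

Lemma lconst_mull (K : comNzRingType) (a : K) (f : laurent K) n : (lconst a * f) n = a * f n.
Proof. by apply: lconv_lconstl; split=> *; rewrite (mulrDl, mulrDr). Qed.

Lemma lconstM (K : comNzRingType) (a b : K) : lconst (a * b) = lconst a * lconst b.
Proof.
by apply: laurentP => n; rewrite lconst_mull !lconstE; case: eqP; rewrite ?mulr0.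
Qed.

Section Kconst.
Variable K : fieldType.
Implicit Types (a b : K) (n : nat).

Lemma kconstD n a b : kconst n (a + b) = kconst n a + kconst n b.
Proof. by elim: n => //= n ->; rewrite lconstD. Qed.

Lemma kconstM n a b : kconst n (a * b) = kconst n a * kconst n b.
Proof. by elim: n => //= n ->; rewrite lconstM. Qed.

Lemma kconst1 n : kconst n (1 : K) = 1.
Proof. by elim: n => //= n ->. Qed.

Lemma kconst0 n : kconst n (0 : K) = 0.
Proof. by elim: n => //= n ->; rewrite lconst0. Qed.
End Kconst.

(** The substitution x = x_{i+1}, from F((t))((x)) to F((t))((x_1))...((x_n)); it carries f(t+x) to
    f(t+x_{i+1}). *)
Fixpoint kemb (F : fieldType) (n i : nat) (f : laurent (laurent F)) :
    iterK n (laurent F) :=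
  if n is m.+1 then if i == m then lmap (kconst m) f else lconst (kemb m i f) else 0.

(** * Scalars in products of vertex operators *)

Section Action.
Variables (F : fieldType) (V : vdata F) (hV : is_nonlocal_tva V).

Lemma tact_biadditive : biadditive (tact : laurent F -> V -> V).
Proof.
split=> [f g v|f x y]; first exact: (tactDl hV).
by have := tact_linear hV f 1 x y; rewrite !scale1r.
Qed.

Lemma tact1 (v : V) : tact 1 v = v.
Proof. by rewrite -[1]/(lconst 1) (tactC hV) scale1r. Qed.

Lemma vY_biadditive : biadditive (@vY F V).
Proof.
split=> [a b y|a x y].
  by have := vY_linearl hV y 1 a b; rewrite !scale1r.
by have := vY_linearr hV a 1 x y; rewrite !scale1r.
Qed.

Lemma iter_tact_biadditive n : biadditive (@iter_tact F V n).
Proof. by elim: n => [|n IH]; [exact: tact_biadditive|exact: lconv_biadditive]. Qed.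

Lemma iter_tactM n g h y :
  @iter_tact F V n (g * h) y = iter_tact g (iter_tact h y).
Proof.
elim: n g h y => [|n IH] g h y; first exact: (tactM hV).
exact: (lconv_act (iter_tact_biadditive n) IH).
Qed.

Lemma iter_tact_kconst n (c : F) y : @iter_tact F V n (kconst n (lconst c)) y = c *: y.
Proof.
elim: n c y => [|n IH] c y; first exact: (tactC hV).
by apply: laurentP => k; rewrite /= (lconv_lconstl (iter_tact_biadditive n)) IH.
Qed.

Lemma iter_tact1 n y : @iter_tact F V n 1 y = y.
Proof. by rewrite -(kconst1 _ n) iter_tact_kconst scale1r. Qed.

Lemma iter_tactZ n g c (y : iterL n V) : iter_tact g (c *: y) = c *: iter_tact g y.
Proof. by rewrite -!iter_tact_kconst -!iter_tactM mulrC. Qed.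

Lemma Yprod_linear n c (v : 'I_n -> V) x y :
  Yprod v (c *: x + y) = c *: Yprod v x + Yprod v y.
Proof.
elim: n c v x y => [|n IH] c v x y //.
have Y0 (u : 'I_n -> V) : Yprod u 0 = 0.
  by have := IH (-1) u 0 0; rewrite !scaleN1r oppr0 addr0 addNr.
pose v' i := v (widen_ord (leqnSn n) i).
apply: laurentP => k; change (lmap (Yprod v') (vY (v ord_max) (c *: x + y)) k =
  c *: lmap (Yprod v') (vY (v ord_max) x) k + lmap (Yprod v') (vY (v ord_max) y) k).
rewrite !lmapE//; by rewrite (vY_linearr hV) lcoefD lcoefZ IH.
Qed.

Lemma YprodD n (v : 'I_n -> V) x y : Yprod v (x + y) = Yprod v x + Yprod v y.
Proof. by have := Yprod_linear 1 v x y; rewrite !scale1r. Qed.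

Lemma Yprod0 n (v : 'I_n -> V) : Yprod v 0 = 0.
Proof. by apply: (addrI (Yprod v 0)); rewrite -YprodD !addr0. Qed.

Lemma Yprod_sum n (v : 'I_n -> V) (I : Type) (r : seq I) (f : I -> V) :
  Yprod v (\sum_(i <- r) f i) = \sum_(i <- r) Yprod v (f i).
Proof. exact: (big_morph _ (YprodD v) (Yprod0 v)). Qed.

Lemma Yprod_multilinear n (v : 'I_n -> V) i c x y w :
  Yprod (vupd v i (c *: x + y)) w = c *: Yprod (vupd v i x) w + Yprod (vupd v i y) w.
Proof.
elim: n v i w => [|n IH] v i w; first by case: i.
pose r (u : 'I_n.+1 -> V) := (fun j : 'I_n => u (widen_ord (leqnSn n) j)).
apply: laurentP => k; pose y' z := lmap (Yprod (r (vupd v i z))) (vY (vupd v i z ord_max) w) k.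
change (y' (c *: x + y) = c *: y' x + y' y); rewrite /y' !lmapE ?Yprod0//.
have [im|im] := eqVneq i ord_max.
  have e z : r (vupd v i z) = r v.
    apply/funext => j; rewrite /r /vupd ifN// im.
    by apply/eqP => /(congr1 val) /= jn; have := ltn_ord j; rewrite jn ltnn.
  by rewrite !e /vupd im eqxx (vY_linearl hV) lcoefD lcoefZ Yprod_linear.
have lt_in : (i < n)%N.
  by have := ltn_ord i; rewrite ltnS leq_eqVlt => /orP[/eqP h|//]; case/eqP: im; apply/val_inj.
have e z : r (vupd v i z) = vupd (r v) (Ordinal lt_in) z.
  by apply/funext => j.
have vm z : vupd v i z ord_max = v ord_max by rewrite /vupd eq_sym (negbTE im).
by rewrite !vm !e IH.
Qed.

Lemma ltaylor1 : ltaylor (1 : laurent F) = 1.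
Proof.
have d0 : lderiv (0 : laurent F) = 0.
  by apply: laurentP => m; rewrite /lderiv (@lofE _ _ 0)// => *; rewrite mul0rz.
have d1 : lderiv (1 : laurent F) = 0.
  have e j : (lconst (1 : F) (j + 1)) *~ (j + 1) = 0.
    by rewrite lconstE; case: eqP => [->|_]; rewrite ?mulr0z ?mul0rz.
  apply: laurentP => m; rewrite -[1]/(lconst 1) /lderiv (@lofE _ _ 0) ?e//.
apply: laurentP => k; rewrite -[in RHS]/(lconst (1 : laurent F)) /ltaylor /lps lpowE lconstE subr0.
have [->|k0] := eqVneq k 0; first by rewrite lexx absz0 /= fact0 invr1 mulr1.
case: ifP => // k1; have -> : iter `|k| (@lderiv F) 1 = 0; last exact: mulr0.
have : (0 < `|k|)%N by lia.
by case: `|k|%N => // j _; rewrite iterSr d1; elim: j => //= j ->.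
Qed.

(** The case f = 1 of [vY_tact]: the constant 1 is invariant under translation, so the scalar of the
    right argument comes out untouched. *)
Lemma vY_tactr g (u v : V) n : vY u (tact g v) n = tact g (vY u v n).
Proof.
rewrite -{1}(tact1 u) (vY_tact hV) ltaylor1 mul1r.
exact: (lconv_lconstl tact_biadditive).
Qed.

Lemma vY_tactl f (u v : V) : vY (tact f u) v = lconv tact (ltaylor f) (vY u v).
Proof.
have e : lconst (1 : laurent F) = 1 by [].
by rewrite -{1}(tact1 v) (vY_tact hV) e mulr1.
Qed.

Lemma Yprod_tactr n (v : 'I_n -> V) g w :
  Yprod v (tact g w) = iter_tact (kconst n g) (Yprod v w).
Proof.
elim: n v w => [|n IH] v w //; apply: laurentP => k /=.
rewrite (lconv_lconstl (iter_tact_biadditive n)) !lmapE ?Yprod0//.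
by rewrite vY_tactr IH.
Qed.

(** A scalar f(t) of the vector in Y(v_j,x_j) comes out as f(t+x_j); the coefficients of this series
    lie in F((t)) and pass unchanged through the operators further left, by [Yprod_tactr]. *)
Lemma Yprod_tactl n (h : 'I_n -> laurent F) (v : 'I_n -> V) w :
  Yprod (fun i => tact (h i) (v i)) w =
  iter_tact (\prod_(i < n) kemb n i (ltaylor (h i))) (Yprod v w).
Proof.
elim: n h v w => [|n IH] h v w; first by rewrite big_ord0 iter_tact1.
apply: laurentP => k; rewrite big_ord_recr /= eqxx.
pose h' i := h (widen_ord (leqnSn n) i); pose v' i := v (widen_ord (leqnSn n) i).
have -> : \prod_(i < n) (if i == n :> nat then lmap (kconst n) (ltaylor (h' i)) else
    lconst (kemb n i (ltaylor (h' i)))) = lconst (\prod_(i < n) kemb n i (ltaylor (h' i))).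
  rewrite (big_morph _ (@lconstM _) (erefl : lconst 1 = 1)).
  by apply: eq_bigr => i _; rewrite ifF// ltn_eqF.
rewrite (lconv_act (iter_tact_biadditive n) (@iter_tactM n)).
rewrite (lconv_lconstl (iter_tact_biadditive n)) lmapE ?Yprod0// (IH h' v') vY_tactl.
congr iter_tact.
have [L1 h1] := lconv_wsum tact_biadditive (ltaylor (h ord_max)) (vY (v ord_max) w) k.
have [L2 h2] := lconv_wsum (iter_tact_biadditive n)
  (lmap (kconst n) (ltaylor (h ord_max))) (lmap (Yprod v') (vY (v ord_max) w)) k.
rewrite (h1 (L1 + L2)%N) ?(h2 (L1 + L2)%N); try lia.
rewrite Yprod_sum; apply: eq_bigr => i _.
by rewrite Yprod_tactr !lmapE ?Yprod0 ?kconst0.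
Qed.
End Action.

(** * Expansion and translation of fractions *)

Local Notation "x %:F" := (@FracField.tofrac _ x) (format "x %:F").

(** A proposition and not a structure, so that it can be proved by induction on the number of
    variables; [to_rmorphism] packs it on demand. *)
Definition ring_morph (R S : pzRingType) (phi : R -> S) :=
  zmod_morphism phi /\ monoid_morphism phi.

Definition to_rmorphism (R S : pzRingType) (phi : R -> S) (h : ring_morph phi) :
    {rmorphism R -> S} :=
  HB.pack phi (GRing.isZmodMorphism.Build R S phi (proj1 h))
    (GRing.isMonoidMorphism.Build R S phi (proj2 h)).

Lemma ring_morphP (R S : pzRingType) (phi : R -> S) :
  (forall a b, phi (a + b) = phi a + phi b) ->
  (forall a b, phi (a * b) = phi a * phi b) -> phi 1 = 1 -> ring_morph phi.
Proof.
move=> hD hM h1; split=> [a b|//].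
by apply: (addIr (phi b)); rewrite -hD !subrK.
Qed.

Lemma ring_morph_nat (R S : pzRingType) (phi : R -> S) k :
  ring_morph phi -> phi k%:R = k%:R.
Proof. by move=> h; exact: (rmorph_nat (to_rmorphism h)). Qed.

Lemma ring_morph_comp (R S T : pzRingType) (phi : S -> T) (psi : R -> S) :
  ring_morph phi -> ring_morph psi -> ring_morph (phi \o psi).
Proof.
move=> [phiB [phi1 phiM]] [psiB [psi1 psiM]]; split=> [a b|] /=; first by rewrite psiB phiB.
by split=> [|a b] /=; rewrite ?psi1 ?phi1 ?psiM ?phiM.
Qed.

Section FracExt.
Variables (R : idomainType) (K : fieldType) (phi : R -> K).
Hypotheses (hphi : ring_morph phi) (phi_inj : injective phi).

Let phiE a b : b != 0 -> frac_ext phi (a%:F / b%:F) = phi a / phi b.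
Proof. exact: (@frac_extE _ _ (to_rmorphism hphi)). Qed.

Lemma frac_ext_tofrac a : frac_ext phi a%:F = phi a.
Proof.
by rewrite -[a%:F]divr1 -tofrac1 phiE ?oner_neq0// (proj2 hphi).1 divr1.
Qed.

Lemma frac_ext_morph : ring_morph (frac_ext phi).
Proof.
pose f := to_rmorphism hphi; have nz b : b != 0 -> phi b != 0.
  by rewrite -(rmorph0 f); apply: contraNneq => /phi_inj ->.
have rep x : exists a b, [/\ b != 0, phi b != 0 & x = a%:F / b%:F].
  have b0 : (\d_(repr x))%qT != 0 by exact: denom_ratioP.
  by exists (\n_(repr x))%qT, (\d_(repr x))%qT; split; [|exact: nz|exact: frac_numden].
apply: ring_morphP => [x y|x y|].
- have [a [b [b0 pb0 ->]]] := rep x; have [c [d [d0 pd0 ->]]] := rep y.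
  rewrite addf_div ?tofrac_eq0// -!tofracM -tofracD !phiE ?mulf_neq0//.
  by rewrite -[phi]/(f : _ -> _) rmorphD !rmorphM addf_div.
- have [a [b [b0 pb0 ->]]] := rep x; have [c [d [d0 pd0 ->]]] := rep y.
  rewrite mulf_div -!tofracM !phiE ?mulf_neq0//.
  by rewrite -[phi]/(f : _ -> _) !rmorphM mulf_div.
- by rewrite -tofrac1 frac_ext_tofrac (proj2 hphi).1.
Qed.
End FracExt.

Section Taylor.
Variables (R : idomainType) (D : R -> R) (c : nat -> R).
Hypothesis DD : forall f g, D (f + g) = D f + D g.
Hypothesis DM : forall f g, D (f * g) = D f * g + f * D g.
Hypothesis cE : forall k, c k * k`!%:R = 1.

Let d k f := c k * iter k D f.

Let D0 : D 0 = 0. Proof. by apply: (addrI (D 0)); rewrite -DD !addr0. Qed.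

Let D1 : D 1 = 0.
Proof. by apply: (addrI (D 1)); rewrite addr0 -{3}[1]mulr1 DM mulr1 mul1r. Qed.

Let nat_neq0 k : k.+1%:R != 0 :> R.
Proof.
apply/eqP => h; have /eqP := cE k.+1; rewrite factS natrM h mul0r mulr0 eq_sym.
by rewrite oner_eq0.
Qed.

Let Dc k f : D (c k * f) = c k * D f.
Proof.
have Dn n : D n%:R = 0 by elim: n => [//|n IH]; rewrite -natr1 DD IH D1 addr0.
have f0 : k`!%:R != 0 :> R.
  by apply/eqP => h; have /eqP := cE k; rewrite h mulr0 eq_sym oner_eq0.
suff -> : D (c k * f) = D (c k) * f + c k * D f.
  suff -> : D (c k) = 0 by rewrite mul0r add0r.
  by apply/(mulIf f0); have := DM (c k) k`!%:R; rewrite cE D1 Dn mulr0 addr0 mul0r.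
exact: DM.
Qed.

Let dS k f : d k.+1 f *+ k.+1 = D (d k f).
Proof.
have f0 : k`!%:R != 0 :> R.
  by apply/eqP => h; have /eqP := cE k; rewrite h mulr0 eq_sym oner_eq0.
rewrite /d Dc -mulrnAl; congr (_ * _); apply: (mulIf f0).
by rewrite cE -mulr_natr -mulrA -natrM -factS cE.
Qed.

(** The divided powers d_k = D^k/k! satisfy (k+1) d_{k+1} = D d_k, since D kills c_k by c_k k! = 1.
    The Leibniz rule follows by induction after multiplication by k+1, which is nonzero. The
    constants c_k are abstract because the lemma serves both e^{x d/dt} on F((t)) and the
    translation by t of series in n variables. *)
Lemma taylorM k f g :
  c k * iter k D (f * g) = \sum_(i < k.+1) (c i * iter i D f) * (c (k - i)%N * iter (k - i) D g).
Proof.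
rewrite -/(d _ _); under eq_bigr do rewrite -/(d _ f) -/(d _ g).
elim: k => [|k IH].
  have c0 : c 0%N = 1 by have := cE 0; rewrite fact0 mulr1.
  by rewrite big_ord1 /d c0 !mul1r.
apply: (mulIf (nat_neq0 k)); rewrite !mulr_natr dS IH.
rewrite (big_morph D DD D0) -sumrMnl.
(* The splitting k+1 = i + (k+1-i) separates the two terms of the product rule. *)
transitivity (\sum_(i < k.+2) (d i f *+ i) * d (k.+1 - i)%N g
            + \sum_(i < k.+2) d i f * (d (k.+1 - i)%N g *+ (k.+1 - i))); last first.
  rewrite -big_split; apply: eq_bigr => i _ /=; rewrite mulrnAl mulrnAr -mulrnDr.
  by rewrite subnKC// -ltnS.
rewrite [X in _ = X + _]big_ord_recl mulr0n mul0r add0r [X in _ = _ + X]big_ord_recr /=.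
rewrite subnn mulr0n mulr0 addr0 -big_split; apply: eq_bigr => i _ /=.
by rewrite DM -!dS subSS subSn// -ltnS.
Qed.
End Taylor.

Section PsnMorphisms.
Variable R : idomainType.

Lemma psC_mull (c : R) (f : pseries R) n : (psC c * f) n = c * f n.
Proof.
rewrite ps_coefM big_ord_recl /psC /= subn0.
by rewrite big1 ?addr0 // => i _; rewrite mul0r.
Qed.

Lemma psC0 : psC (0 : R) = 0.
Proof. by apply/funext => k; rewrite /psC; case: eqP. Qed.

Lemma psC_morph : ring_morph (@psC R).
Proof.
apply: ring_morphP => // a b; apply/funext => k.
  change ((if k == 0%N then a + b else 0) = psC a k + psC b k).
  by rewrite /psC; case: eqP; rewrite ?addr0.
by rewrite psC_mull /psC; case: eqP; rewrite ?mulr0.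
Qed.
End PsnMorphisms.

Lemma psnC_morph (R : idomainType) n : ring_morph (@psnC R n).
Proof.
elim: n => [|n IH]; first exact: ring_morphP.
exact: ring_morph_comp (psC_morph _) IH.
Qed.

Section PartialDerivatives.
Variable R : idomainType.

Lemma pderivD n i (f g : psn n R) : pderiv i (f + g) = pderiv i f + pderiv i g.
Proof.
elim: n f g => [|n IH] f g /=; first by rewrite addr0.
case: eqP => _; apply/funext => k; last exact: IH.
by rewrite -[RHS]mulrnDl.
Qed.

Lemma pderiv0 n i : pderiv i (0 : psn n R) = 0.
Proof. by apply: (addrI (pderiv i 0)); rewrite -pderivD !addr0. Qed.

Lemma pderivM n i (f g : psn n R) : pderiv i (f * g) = pderiv i f * g + f * pderiv i g.
Proof.
elim: n f g => [|n IH] f g /=; first by rewrite mulr0 mul0r addr0.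
case: eqP => _; apply/funext => k.
  change ((\sum_(j < k.+2) f j * g (k.+1 - j)%N) *+ k.+1 =
    \sum_(j < k.+1) (f j.+1 *+ j.+1) * g (k - j)%N +
    \sum_(j < k.+1) f j * (g (k - j).+1 *+ (k - j).+1)).
  rewrite -sumrMnl.
  transitivity (\sum_(j < k.+2) (f j *+ j) * g (k.+1 - j)%N
              + \sum_(j < k.+2) f j * (g (k.+1 - j)%N *+ (k.+1 - j))).
    rewrite -big_split; apply: eq_bigr => j _ /=; rewrite mulrnAl mulrnAr -mulrnDr.
    by rewrite subnKC// -ltnS.
  rewrite big_ord_recl mulr0n mul0r add0r [X in _ + X]big_ord_recr /=.
  rewrite subnn mulr0n mulr0 addr0; congr (_ + _); apply: eq_bigr => j _ //=.
  by rewrite subSn// -ltnS.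
change (pderiv i (\sum_(j < k.+1) f j * g (k - j)%N) =
  \sum_(j < k.+1) pderiv i (f j) * g (k - j)%N + \sum_(j < k.+1) f j * pderiv i (g (k - j)%N)).
rewrite (big_morph _ (@pderivD n i) (pderiv0 n i)) -big_split.
by apply: eq_bigr => j _; rewrite IH.
Qed.

Lemma pderiv_psnC n i (c : R) : pderiv i (psnC n c) = 0.
Proof.
elim: n => //= n IH; case: eqP => _; apply/funext => k.
  exact: mul0rn.
by rewrite /psC; case: eqP => _; rewrite ?IH ?pderiv0.
Qed.

Definition psderiv (g : pseries R) : pseries R := fun k => g k.+1 *+ k.+1.

Lemma pderiv_psub n i j (g : pseries R) : (i < n)%N -> (j < n)%N ->
  pderiv j (psub n i g) = if i == j then psub n i (psderiv g) else 0.
Proof.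
elim: n => // n IH; rewrite ltnS => ilt jlt /=.
have [ein|ein] := eqVneq i n; have [ejn|ejn] := eqVneq j n.
- rewrite ein ejn eqxx; apply/funext => k.
  by rewrite /psderiv; symmetry; exact: (raddfMn (to_rmorphism (psnC_morph R n))).
- by rewrite ein eq_sym (negbTE ejn); apply/funext => k; rewrite pderiv_psnC.
- rewrite ejn (negbTE ein); apply/funext => k; exact: mul0rn.
- have e k : pderiv j (psC (psub n i g) k) = psC (pderiv j (psub n i g)) k.
    by rewrite /psC; case: eqP; rewrite ?pderiv0.
  have IHn : pderiv j (psub n i g) = if i == j then psub n i (psderiv g) else 0.
    by apply: IH; rewrite ltn_neqAle ?ein ?ejn.
  by apply/funext => k; rewrite e IHn; case: eqP => // _; rewrite psC0.
Qed.
End PartialDerivatives.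

Section Ptr.
Variable R : idomainType.

Lemma ptrD n (g h : pseries (psn n R)) : ptr (g + h : pseries _) = ptr g + ptr h.
Proof. by elim: n g h => [|n IH] g h //=; apply/funext => k; exact: IH. Qed.

Lemma ptr0 n : ptr (0 : pseries (psn n R)) = 0.
Proof. by apply: (addrI (ptr 0)); rewrite -ptrD !addr0. Qed.

Lemma ps_sum (T : zmodType) (I : Type) (r : seq I) (f : I -> pseries T) k :
  (\sum_(i <- r) f i) k = \sum_(i <- r) f i k.
Proof. exact: (big_morph (fun g : pseries T => g k)). Qed.

(** [ptr] only moves t from the outermost to the innermost place; both products are the same
    iterated Cauchy sum with the summations exchanged. *)
Lemma ptrM n (g h : pseries (psn n R)) : ptr (g * h : pseries _) = ptr g * ptr h.
Proof.
elim: n g h => [|n IH] g h //=; apply/funext => k.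
(* [c u b] is the coefficient of x_{n+1}^b in u, as a series in t. *)
pose c (u : pseries (psn n.+1 R)) b : pseries (psn n R) := fun j => u j b.
change (ptr (c (g * h) k) = \sum_(b < k.+1) ptr (c g b) * ptr (c h (k - b)%N)).
transitivity (\sum_(b < k.+1) ptr (c g b * c h (k - b)%N : pseries (psn n R))); last first.
  by apply: eq_bigr => b _; rewrite IH.
rewrite -(big_morph _ (@ptrD n) (ptr0 n)); congr ptr; apply/funext => j.
rewrite ps_sum /c ps_coefM.
transitivity (\sum_(a < j.+1) \sum_(b < k.+1) g a b * h (j - a)%N (k - b)%N).
  exact: (big_morph (fun f : pseries (psn n R) => f k)).
by rewrite exchange_big; apply: eq_bigr => b _; rewrite ps_coefM.
Qed.

Lemma ptr_psnC n (a : pseries R) : ptr (fun k => psnC n (a k)) = psnC n a.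
Proof.
elim: n => //= n IH; apply/funext => k; rewrite /psC.
by case: eqP => _; [exact: IH|exact: ptr0].
Qed.

Lemma ptr_inj n : injective (ptr (n := n) : (nat -> psn n R) -> _).
Proof.
elim: n => [|n IH] g h //= e; apply/funext => j; apply/funext => k.
have /IH/(congr1 (fun f : nat -> psn n R => f j)) := congr1 (fun f : pseries _ => f k) e.
exact.
Qed.

Lemma ptr_psub n i (G : nat -> pseries R) : (i < n)%N ->
  ptr (fun j => psub n i (G j)) = psub n i (fun k => (fun j => G j k) : pseries R).
Proof.
elim: n => // n IH; rewrite ltnS leq_eqVlt /=; case: eqP => [->|_] /= lt_in; apply/funext => k.
  exact: ptr_psnC.
by rewrite /psC; case: eqP => // _; [exact: IH|exact: ptr0].
Qed.
End Ptr.

Section Psiota.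
Variables (R : idomainType) (K : fieldType) (phi : R -> K).
Hypothesis hphi : ring_morph phi.

Lemma lpsE (U : zmodType) (p : pseries U) (k : nat) : lps p k = p k.
Proof. by rewrite /lps lpowE subr0. Qed.

Lemma lps_const (L : comNzRingType) (c : L) : lps (psC c) = lconst c.
Proof. by rewrite lconst_pow. Qed.

Lemma psiota_const n c : psiota phi (psnC n c) = kconst n (phi c).
Proof.
have phi0 : phi 0 = 0 by exact: (raddf0 (to_rmorphism hphi)).
have z m : psiota phi (0 : psn m R) = 0.
  elim: m => [|m IH]; first exact: phi0.
  by apply: laurentP => j; rewrite /= /lps lpowE; case: ifP.
elim: n => [|n IH]; first exact: erefl.
rewrite /= -IH -lps_const; congr lps; apply/funext => k.
by rewrite /psC; case: eqP => _ //; exact: z.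
Qed.

Lemma psiota_morph n : ring_morph (psiota phi (n := n)).
Proof.
have p1 m : psiota phi (1 : psn m R) = 1.
  by rewrite -psnC1 psiota_const (proj2 hphi).1 kconst1.
elim: n => [|n IH]; first exact: hphi.
pose f := to_rmorphism IH.
apply: ring_morphP (p1 n.+1) => a b.
  rewrite /= /lps lpowD; congr lpow; apply/funext => k; exact: (raddfD f).
rewrite /= /lps lpowM addr0; congr lpow; apply/funext => k.
change (f (\sum_(i < k.+1) a i * b (k - i)%N) = \sum_(i < k.+1) f (a i) * f (b (k - i)%N)).
by rewrite raddf_sum; apply: eq_bigr => i _; exact: (proj2 IH).2.
Qed.

Lemma psiota_inj n : injective phi -> injective (psiota phi (n := n)).
Proof.
move=> inj; elim: n => [|n IH] //= f g e; apply/funext => k; apply: IH.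
by have := congr1 (fun h : laurent _ => h k) e; rewrite !lpsE.
Qed.
End Psiota.

Lemma lps_morph (K : fieldType) : ring_morph (@lps K).
Proof.
apply: ring_morphP => [a b|a b|]; rewrite /lps ?lpowD ?lpowM ?addr0//.
exact: lpow1.
Qed.

Lemma lps_inj (U : zmodType) : injective (@lps U).
Proof. by move=> p q e; apply/funext => k; rewrite -[LHS]lpsE e lpsE. Qed.

Lemma lmap_lps (U W : zmodType) (phi : U -> W) (p : pseries U) :
  phi 0 = 0 -> lmap phi (lps p) = lps (fun k => phi (p k)).
Proof.
by move=> phi0; apply: laurentP => k; rewrite lmapE// /lps !lpowE; case: ifP.
Qed.

Lemma lmap_morph (K L : fieldType) (phi : K -> L) : ring_morph phi -> ring_morph (lmap phi).
Proof.
move=> h; pose f := to_rmorphism h; have phi0 : phi 0 = 0 by exact: (raddf0 f).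
apply: ring_morphP => [a b|a b|].
- apply: laurentP => k; rewrite lcoefD !lmapE//; exact: (raddfD f).
- elim/lpow_ind: a => a p; elim/lpow_ind: b => b q.
  have e c (r : pseries K) : lmap phi (lpow c r) = lpow c (fun k => phi (r k)).
    by apply: laurentP => k; rewrite lmapE// !lpowE; case: ifP.
  rewrite lpowM !e lpowM; congr lpow; apply/funext => k.
  change (f (\sum_(i < k.+1) p i * q (k - i)%N) = \sum_(i < k.+1) f (p i) * f (q (k - i)%N)).
  by rewrite raddf_sum; apply: eq_bigr => i _; exact: (proj2 h).2.
- apply: laurentP => k; rewrite lmapE// -[1 : laurent K]/(lconst 1) -[1 : laurent L]/(lconst 1).
  by rewrite !lconstE; case: eqP => // _; rewrite (proj2 h).1.
Qed.

Lemma kconst_morph (K : fieldType) n : ring_morph (@kconst K n).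
Proof. apply: ring_morphP; [exact: kconstD|exact: kconstM|exact: kconst1]. Qed.

Lemma lconst_morph (K : fieldType) : ring_morph (@lconst K).
Proof. exact: kconst_morph 1. Qed.

Lemma kemb_morph (F : fieldType) n i : (i < n)%N -> ring_morph (@kemb F n i).
Proof.
elim: n => // n IH; rewrite ltnS leq_eqVlt /=; case: eqP => [_ _|_ /= /IH h].
  exact/lmap_morph/kconst_morph.
exact: ring_morph_comp (lconst_morph _) h.
Qed.

Lemma psiota_psub (F : fieldType) n i (G : pseries (pseries F)) : (i < n)%N ->
  psiota (@lps F) (psub n i G) = kemb n i (lps (fun k => lps (G k))).
Proof.
elim: n => // n IH; rewrite ltnS leq_eqVlt /=; case: eqP => [_ _|_ /= lt_in].
  rewrite lmap_lps ?kconst0//; congr lps; apply/funext => k.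
  exact/psiota_const/lps_morph.
rewrite -IH// -lps_const; congr lps; apply/funext => k; rewrite /psC; case: eqP => // _.
exact: (raddf0 (to_rmorphism (psiota_morph (lps_morph F) n))).
Qed.

(** * Translation by t in characteristic zero *)

Section CharZero.
Variables (F : fieldType) (charF : [pchar F] =i pred0).

Lemma fact_neq0 k : k`!%:R != 0 :> F.
Proof. by rewrite (proj1 (pcharf0P F) charF) -lt0n fact_gt0. Qed.

Let pd n (g : psn n F) := \sum_(i < n) pderiv i g.

Let pdD n (f g : psn n F) : pd (f + g) = pd f + pd g.
Proof. by rewrite /pd -big_split; apply: eq_bigr => i _; rewrite pderivD. Qed.

Let pdM n (f g : psn n F) : pd (f * g) = pd f * g + f * pd g.
Proof.
rewrite /pd mulr_suml mulr_sumr -big_split; apply: eq_bigr => i _; exact: pderivM.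
Qed.

Let psnCfact n k : psnC n (k`!%:R)^-1 * k`!%:R = 1 :> psn n F.
Proof.
have e : k`!%:R = psnC n (k`!%:R : F) by rewrite (ring_morph_nat _ (psnC_morph F n)).
by rewrite e -(proj2 (psnC_morph F n)).2 mulVf ?fact_neq0// psnC1.
Qed.

Let pd_psnC n c : pd (psnC n (c : F)) = 0.
Proof. by rewrite /pd big1// => i _; rewrite pderiv_psnC. Qed.

Let pd0 n : pd (0 : psn n F) = 0.
Proof. by rewrite -[in LHS](psnC0 F n) pd_psnC. Qed.

Let iter_pd0 n k : iter k (@pd n) 0 = 0.
Proof. by elim: k => //= k ->; exact: pd0. Qed.

Let iter_pd_psnC n c k : iter k (@pd n) (psnC n c) = if k == 0%N then psnC n c else 0.
Proof. by case: k => // k; rewrite iterSr pd_psnC iter_pd0. Qed.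

Lemma pshift_psnC n (c : F) : pshift (psnC n c) = psnC n (psC c).
Proof.
rewrite /pshift -ptr_psnC; congr ptr; apply/funext => k.
rewrite (iter_pd_psnC n c k) /psC; case: eqP => [->|_]; last by rewrite mulr0 psnC0.
by rewrite fact0 invr1 psnC1 mul1r.
Qed.

Lemma pshift_morph n : ring_morph (@pshift F n).
Proof.
apply: ring_morphP => [f g|f g|].
- rewrite /pshift -ptrD; congr ptr; apply/funext => k.
  change (psnC n k`!%:R^-1 * iter k (@pd n) (f + g) =
    psnC n k`!%:R^-1 * iter k (@pd n) f + psnC n k`!%:R^-1 * iter k (@pd n) g).
  by rewrite -mulrDr; congr (_ * _); elim: k => //= k ->; exact: pdD.
- rewrite /pshift -ptrM; congr ptr; apply/funext => k.
  exact: (taylorM (@pdD n) (@pdM n) (psnCfact n)).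
- by rewrite -[in LHS]psnC1 pshift_psnC; exact: psnC1.
Qed.

Lemma pshift_inj n : injective (@pshift F n).
Proof.
move=> f g /ptr_inj/(congr1 (fun h : nat -> psn n F => h 0%N)) /=.
by rewrite fact0 invr1 psnC1 !mul1r.
Qed.

Lemma pd_psub n i g k : (i < n)%N ->
  iter k (@pd n) (psub n i g) = psub n i (iter k (@psderiv F) g).
Proof.
move=> lt_in; elim: k => //= k ->; rewrite /pd (bigD1 (Ordinal lt_in))//=.
rewrite pderiv_psub// eqxx big1 ?addr0// => j /eqP jn.
by rewrite pderiv_psub// ifF//; apply/eqP => e; apply: jn; apply/val_inj.
Qed.

Lemma psub_scale n i c (g : pseries F) : (i < n)%N ->
  psnC n c * psub n i g = psub n i (fun k => c * g k).
Proof.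
elim: n => // n IH; rewrite ltnS leq_eqVlt /=; case: eqP => [_ _|_ /= /IH e].
  apply/funext => k; rewrite psC_mull; symmetry; exact: (proj2 (psnC_morph F n)).2.
by rewrite -(proj2 (psC_morph _)).2 e.
Qed.

Lemma iter_psderiv j k (g : pseries F) :
  iter j (@psderiv F) g k * k`!%:R = g (j + k)%N * (j + k)`!%:R.
Proof.
elim: j k => [|j IH] k //=; rewrite /psderiv mulrnAl -mulrnAr -mulr_natr -natrM mulnC -factS.
by rewrite IH addnS.
Qed.

Lemma iter_lderiv_lps j (g : pseries F) :
  iter j (@lderiv F) (lps g) = lps (iter j (@psderiv F) g).
Proof.
elim: j => //= j ->; set h := iter _ _ _; apply: laurentP => k.
rewrite /lderiv (@lofE _ _ (-1)) => [|m m1]; rewrite /lps !lpowE.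
  have [k0|k0] := leP 0 k; last first.
    case: ifP => k1; last exact: mul0rz.
    by rewrite (_ : k + 1 = 0) ?mulr0z//; lia.
  rewrite ifT; last by lia.
  by case: k k0 => // k _; rewrite !subr0 -PoszD addn1 /= /psderiv pmulrn.
by rewrite ifF ?mul0rz//; lia.
Qed.

(** On the left the coefficient of t^m x^k comes from the k-th derivative in t, on the right from
    the m-th derivative in x; by [iter_psderiv] both are binom(m+k,k) g_{m+k}. This matches
    [ltaylor], which enters the axioms of V, with [pshift], which enters Z_n. *)
Lemma ltaylor_lps (g : pseries F) :
  ltaylor (lps g) = lps (fun k => lps (fun j => (j`!%:R)^-1 * iter j (@psderiv F) g k)).
Proof.
rewrite /ltaylor; congr lps; apply/funext => k; rewrite iter_lderiv_lps.
apply: laurentP => m; rewrite lconst_mull.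
rewrite /lps !lpowE; case: leP => m0; last by rewrite mulr0.
move: `|_|%N => j; have f0 := fact_neq0; apply: (mulfI (f0 k)); apply: (mulfI (f0 j)).
rewrite mulVKf// [RHS]mulrCA mulVKf// mulrC iter_psderiv.
by rewrite [RHS]mulrC iter_psderiv addnC.
Qed.

Lemma psiota_pshift_psub n i g : (i < n)%N ->
  psiota (@lps F) (pshift (psub n i g)) = kemb n i (ltaylor (lps g)).
Proof.
move=> lt_in; rewrite ltaylor_lps -psiota_psub// -(@ptr_psub _ n i (fun j => fun k =>
  (j`!%:R)^-1 * iter j (@psderiv F) g k))//; congr psiota; congr ptr; apply/funext => k.
by rewrite pd_psub// psub_scale.
Qed.

Lemma lderivD (f g : laurent F) : lderiv (f + g) = lderiv f + lderiv g.
Proof.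
have e h k : lderiv h k = h (k + 1) *~ (k + 1) :> F.
  have [N hN] := lower_truncatedP _ (lcoefP h).
  by rewrite /lderiv (@lofE _ _ (N - 1)) => [//|m mN]; rewrite hN ?mul0rz//; lia.
by apply: laurentP => k; rewrite lcoefD !e lcoefD mulrzDl.
Qed.

Lemma lderiv_lpow a (p : pseries F) :
  lderiv (lpow a p) = lpow (a - 1) (fun k => p k *~ (a + k%:Z)).
Proof.
apply: laurentP => k; rewrite /lderiv (@lofE _ _ (a - 1)) ?lpowE; last first.
  by move=> m ma; rewrite lpowE ifF ?mul0rz//; lia.
case: leP => ak; last by rewrite ifF ?mul0rz//; lia.
rewrite ifT; last by lia.
by congr (p _ *~ _); lia.
Qed.

Lemma lderivM (f g : laurent F) : lderiv (f * g) = lderiv f * g + f * lderiv g.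
Proof.
elim/lpow_ind: f => a p; elim/lpow_ind: g => b q.
have e1 : a - 1 + b = a + b - 1 by rewrite addrAC.
have e2 : a + (b - 1) = a + b - 1 by rewrite addrA.
rewrite lpowM 3!lderiv_lpow 2!lpowM e1 e2.
rewrite lpowD; congr lpow; apply/funext => k.
change ((\sum_(i < k.+1) p i * q (k - i)%N) *~ (a + b + k%:Z) =
  \sum_(i < k.+1) (p i *~ (a + i%:Z)) * q (k - i)%N +
  \sum_(i < k.+1) p i * (q (k - i)%N *~ (b + (k - i)%N%:Z))).
rewrite mulrz_suml -big_split; apply: eq_bigr => i _ /=.
rewrite mulrzAl mulrzAr -mulrzDr; congr (_ *~ _); move: (ltn_ord i) => /=.
by move: (nat_of_ord i) => m mk; lia.
Qed.

Lemma ltaylor_morph : ring_morph (@ltaylor F).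
Proof.
apply: ring_morphP; last exact: ltaylor1.
- move=> f g; rewrite /ltaylor /lps lpowD; congr lpow; apply/funext => k.
  rewrite -[RHS]mulrDr; congr (_ * _).
  by elim: k => //= k ->; rewrite lderivD.
- move=> f g; rewrite /ltaylor -(proj2 (lps_morph _)).2; congr lps; apply/funext => k.
  pose c j : laurent F := lconst (j`!%:R)^-1.
  have cE j : c j * j`!%:R = 1.
    have e : j`!%:R = lconst (j`!%:R : F) :> laurent F.
      by rewrite (ring_morph_nat _ (lconst_morph F)).
    by rewrite e -lconstM mulVf ?fact_neq0.
  exact: (taylorM lderivD lderivM cE).
Qed.

Let psiota_lps_morph n := psiota_morph (lps_morph F) n.
Let psiota_lps_inj n : injective (psiota (@lps F) (n := n)).
Proof. exact: (psiota_inj (@lps_inj F)). Qed.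

Let tofrac_pshift_morph n : ring_morph (fun f : psn n F => (pshift f)%:F).
Proof.
apply: ring_morphP => [f g|f g|].
- by rewrite -tofracD; congr (_ %:F); exact: (raddfD (to_rmorphism (pshift_morph n))).
- by rewrite (proj2 (pshift_morph n)).2 tofracM.
- by rewrite (proj2 (pshift_morph n)).1 tofrac1.
Qed.

Let tofrac_pshift_inj n : injective (fun f : psn n F => (pshift f)%:F).
Proof. by move=> f g /eqP; rewrite tofrac_eq => /eqP /pshift_inj. Qed.

Let shift_morph n : ring_morph
  (frac_ext (psiota (@lps F) (n := n)) \o fshift (n := n) : {fraction psn n F} -> iterK n (laurent F)).
Proof.
exact: ring_morph_comp (frac_ext_morph (psiota_lps_morph n) (@psiota_lps_inj n))
  (frac_ext_morph (tofrac_pshift_morph n) (@tofrac_pshift_inj n)).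
Qed.

Lemma iota_shift_morph n : ring_morph (@iota_shift F n).
Proof.
have [hB [h1 hM]] := shift_morph n; split=> [f g|]; first exact: hB.
by split=> [|f g]; [exact: h1|exact: hM].
Qed.

Lemma iota_shift_inj n : injective (@iota_shift F n).
Proof.
move=> f g e; apply/val_inj/eqP; rewrite -subr_eq0.
have [hB [h1 hM]] := shift_morph n.
(* The inverse is taken in the fraction field of the power series; it need not lie in F_*. *)
apply/negPn/negP => nz; have /eqP := hM (val f - val g)^-1 (val f - val g).
rewrite mulVf// h1 hB /= -!/(iota_shift _) e subrr mulr0.
by rewrite oner_eq0.
Qed.

Lemma shift_tofrac n (f : psn n F) :
  frac_ext (psiota (@lps F) (n := n)) (fshift f%:F) = psiota (@lps F) (pshift f).
Proof.
rewrite /fshift (frac_ext_tofrac (tofrac_pshift_morph n) (@tofrac_pshift_inj n)).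
by rewrite (frac_ext_tofrac (psiota_lps_morph n) (@psiota_lps_inj n)).
Qed.

Lemma iota_shift_const n (c : F) : iota_shift (fstarC n c) = kconst n (lconst c : laurent F).
Proof.
rewrite /iota_shift shift_tofrac pshift_psnC psiota_const ?lps_const//.
exact: lps_morph.
Qed.

Lemma lps_psX : lps (psX F) = lpow 1 1.
Proof.
have e : (1 : pseries F) = psC 1 by [].
apply: laurentP => k; rewrite e /lps !lpowE /psX /psC.
have [->//|k1] := eqVneq k 1.
transitivity (0 : F); last by case: leP => // k2; rewrite ifF//; lia.
by case: leP => // k0; rewrite (_ : (_ == 1%N) = false)//; lia.
Qed.

Lemma laurent_lbound (h : laurent F) :
  h * lps (psX F) ^+ Defs.lbound h = lps (fun k => h (k%:Z - (Defs.lbound h)%:Z)).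
Proof.
have hN : forall k, k < - (Defs.lbound h)%:Z -> h k = 0 by exact: projT2 (cid (lbound_ex h)).
move: (Defs.lbound h) hN => N hN; set p : pseries F := fun _ => _.
have -> : h = lpow (- N%:Z) p.
  apply: laurentP => k; rewrite lpowE; case: leP => kN; last by rewrite hN.
  by rewrite /p; congr (h _); lia.
have -> : lps (psX F) ^+ N = lpow N%:Z 1.
  elim: N {hN p} => [|N IH]; first by rewrite expr0 lpow1.
  by rewrite exprS IH lps_psX lpowM mul1r intS.
by rewrite lpowM mulr1 addNr.
Qed.

(** Both sides are multiplicative in h. After multiplication by the image of x_{i+1}^N, which is
    nonzero, the pole of h is cleared and [psiota_pshift_psub] applies to power series. *)
Lemma iota_shift_sub n (i : 'I_n) (h : laurent F) :
  iota_shift (fstar_sub i h) = kemb n i (ltaylor h).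
Proof.
have lt_in := ltn_ord i.
have [kB [k1 kM]] := kemb_morph F lt_in; have [tB [t1 tM]] := ltaylor_morph.
set N := Defs.lbound h; set X : psn n F := psub n i (psX F).
pose s : {fraction psn n F} -> _ := frac_ext (psiota (@lps F) (n := n)) \o fshift (n := n).
have [hB [h1 hM]] : ring_morph s := shift_morph n.
have X0 : s (X%:F ^+ N) != 0.
  have XN0 : X%:F ^+ N != 0 by rewrite expf_neq0// tofrac_eq0 psub_neq0.
  apply/eqP => e; have /eqP := hM (X%:F ^+ N)^-1 (X%:F ^+ N).
  by rewrite mulVf// h1 e mulr0 oner_eq0.
apply: (mulIf X0); have -> : iota_shift (fstar_sub i h) * s (X%:F ^+ N) =
    s (psub n i (fun k => h (k%:Z - N%:Z)))%:F.
  rewrite -[RHS](_ : s (val (fstar_sub i h) * X%:F ^+ N) = _); first by rewrite hM.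
  by congr s; rewrite /= divfK// expf_neq0// tofrac_eq0 psub_neq0.
have sX : s (X%:F ^+ N) = kemb n i (ltaylor (lps (psX F) ^+ N)).
  pose f := to_rmorphism (shift_morph n); pose g := to_rmorphism (kemb_morph F lt_in).
  pose t := to_rmorphism ltaylor_morph.
  rewrite -[LHS]/(f _) -[RHS]/(g (t _)) !rmorphXn; congr (_ ^+ N).
  by rewrite -[LHS]/(s _) /s /= shift_tofrac psiota_pshift_psub.
by rewrite sX -kM -tM laurent_lbound /s /= shift_tofrac psiota_pshift_psub.
Qed.
End CharZero.

(** * Relations between iterated vertex operators *)

Section ShiftOp.
Variables (F : fieldType) (V : vdata F) (hV : is_nonlocal_tva V).
Variable B : nat -> V -> V.
Hypothesis BD : forall j x y, B j (x + y) = B j x + B j y.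
Hypothesis Bt : forall j g x, B j (tact g x) = tact g (B j x).

(* Multiplication by sum_j B_j x^j. For B_j w = 'C(a+j,j) u_(-a-j-1) w and
   y = Y(v,x)w it gives the coefficient of x0^a in Y(u,x0+x)Y(v,x)w. *)
Definition shift_op (y : laurent V) : laurent V :=
  lof (fun b => \sum_(j \in [set: nat]) B j (y (b - j%:Z))).

Let B0 j : B j 0 = 0.
Proof. by apply: (addrI (B j 0)); rewrite -BD !addr0. Qed.

Let B_sum j (I : Type) (r : seq I) (f : I -> V) :
  B j (\sum_(i <- r) f i) = \sum_(i <- r) B j (f i).
Proof. exact: (big_morph (B j) (BD j) (B0 j)). Qed.

Let B_trunc (y : laurent V) N b : (forall k, k < N -> y k = 0) -> b < N ->
  \sum_(j \in [set: nat]) B j (y (b - j%:Z)) = 0.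
Proof. by move=> yN bN; rewrite fsbig1// => j _; rewrite yN ?B0//; lia. Qed.

Lemma shift_opE y b : shift_op y b = \sum_(j \in [set: nat]) B j (y (b - j%:Z)).
Proof.
have [N yN] := lower_truncatedP _ (lcoefP y).
by rewrite /shift_op (@lofE _ _ N)// => m mN; apply: B_trunc yN mN.
Qed.

Lemma shift_op_lpow N (q : pseries V) :
  shift_op (lpow N q) = lpow N (fun n => \sum_(j < n.+1) B j (q (n - j)%N)).
Proof.
apply: laurentP => b; rewrite shift_opE lpowE; case: leP => Nb; last first.
  by apply: (B_trunc (N := N)) => // k kN; rewrite lpowE leNgt kN.
rewrite -(@fsbig_widen _ _ _ _ `I_(`|(b - N)%R|%N.+1))//; last first.
  move=> j [_ /= hj]; rewrite lpowE ifF ?B0//; apply/negbTE; lia.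
rewrite -fsbig_ord; apply: eq_bigr => -[j /= jb] _; rewrite lpowE ifT; last by lia.
by congr (B j (q _)); lia.
Qed.

Lemma shift_opD y z : shift_op (y + z) = shift_op y + shift_op z.
Proof.
have [M yM] := lpow_surj y; have [N zN] := lpow_surj z.
have [|p ->] := yM (Num.min M N); first by rewrite ge_min lexx.
have [|q ->] := zN (Num.min M N); first by rewrite ge_min lexx orbT.
rewrite lpowD !shift_op_lpow lpowD; congr lpow; apply/funext => n.
transitivity (\sum_(j < n.+1) (B j (p (n - j)%N) + B j (q (n - j)%N))).
  by apply: eq_bigr => j _; rewrite -BD.
exact: big_split.
Qed.

Lemma shift_op0 : shift_op 0 = 0.
Proof. by apply: (addrI (shift_op 0)); rewrite -shift_opD !addr0. Qed.

Lemma shift_op_sum (I : Type) (r : seq I) (f : I -> laurent V) :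
  shift_op (\sum_(i <- r) f i) = \sum_(i <- r) shift_op (f i).
Proof. exact: (big_morph _ shift_opD shift_op0). Qed.

(** The operators B_j are F((t))-linear and x is central, so only the order of a triple sum
    changes. *)
Lemma shift_op_lconv g y : shift_op (lconv tact g y) = lconv tact g (shift_op y).
Proof.
have tD := tact_biadditive hV; have t0l := biadd0l tD; have t0r := biadd0r tD.
elim/lpow_ind: g => a p; have [N /(_ N (lexx N))[q ->]] := lpow_surj y.
rewrite (lconv_pow t0l t0r) !shift_op_lpow (lconv_pow t0l t0r).
congr lpow; apply/funext => n.
transitivity (\sum_(i < n.+1) \sum_(j < (n - i).+1) B i (tact (p j) (q (n - i - j)%N))).
  by apply: eq_bigr => i _; rewrite B_sum.
rewrite (sum_triangle (fun i j k => B i (tact (p j) (q k)))).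
transitivity (\sum_(i < n.+1) \sum_(j < (n - i).+1) tact (p i) (B j (q (n - i - j)%N))).
  rewrite (sum_triangle (fun i j k => tact (p i) (B j (q k)))).
  (* Reversing the inner sum exchanges the index of B with that of p. *)
  apply: eq_bigr => i _; rewrite (reindex_inj rev_ord_inj) /=.
  apply: eq_bigr => j _; have jS : (j <= i)%N by rewrite -ltnS.
  by rewrite subSS subKn// Bt.
by apply: eq_bigr => i _; rewrite (biadd_sumr tD).
Qed.
End ShiftOp.

Section MulX0X2.
Variables (F : fieldType) (V : vdata F) (hV : is_nonlocal_tva V).
Implicit Types (h : int -> laurent V) (g : laurent (laurent F)).

Let tD := tact_biadditive hV.
Let X : laurent (laurent F) := lpow 1 1.
Let act := lconv (tact : laurent F -> V -> V).

Lemma lconv_tactX y b : act X y b = y (b - 1).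
Proof.
rewrite /act lconvE; [|exact: biadd0l|exact: biadd0r].
have X1 i : X i = if i == 1 then 1 else 0.
  have e : (1 : pseries (laurent F)) = psC 1 by [].
  rewrite /X lpowE e /psC; have [->//|i1] := eqVneq i 1.
  by case: leP => // i2; rewrite ifF//; lia.
by rewrite (fsbigT1 (x := 1)) ?X1 ?eqxx ?(tact1 hV)// => i i1; rewrite X1 (negbTE i1) biadd0l.
Qed.

(* The multiplication by x0 + x2 of series in x0 whose coefficients are Laurent series in x2. *)
Definition lmulx h (a : int) : laurent V := h (a - 1) + act X (h a).

Lemma lmulxE h (f : int -> int -> V) : (forall a b, h a b = f a b) ->
  forall a b, lmulx h a b = mulx0x2 f a b.
Proof. by move=> e a b; rewrite /lmulx lcoefD lconv_tactX !e. Qed.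

Lemma iter_lmulxE l h (f : int -> int -> V) : (forall a b, h a b = f a b) ->
  forall a b, iter l lmulx h a b = iter l (@mulx0x2 F V) f a b.
Proof. by move=> e; elim: l => //= l IH; exact: lmulxE. Qed.

Lemma iter_lmulx_lconv (I : Type) (r : seq I) (g : I -> laurent (laurent F)) l
    (H : I -> int -> laurent V) a :
  iter l lmulx (fun a => \sum_(i <- r) act (g i) (H i a)) a =
  \sum_(i <- r) act (g i) (iter l lmulx (H i) a).
Proof.
elim: l a => //= l IH a; have aD := lconv_biadditive tD.
rewrite {1}/lmulx !IH /act (biadd_sumr aD) -big_split; apply: eq_bigr => i _ /=.
rewrite -!(lconv_act tD (tactM hV)) mulrC (lconv_act tD (tactM hV)).
by rewrite -(proj2 aD).
Qed.

(** Since h is bounded below in x0, induction on a gives x2 h_a = - h_{a-1} = 0, and x2 is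
    invertible. This cancels the power of x0 + x2 in weak associativity. *)
Lemma lmulx_inj0 h N : (forall a, a < N -> h a = 0) ->
  (forall a, lmulx h a = 0) -> forall a, h a = 0.
Proof.
move=> hN h0; suff H k a : a < N + k%:Z -> h a = 0.
  by move=> a; apply: (H (absz (a - N)).+1); lia.
elim: k a => [|k IH] a ak; first by apply: hN; lia.
apply: laurentP => b; have /(congr1 (fun f : laurent V => f (b + 1))) := h0 a.
rewrite /lmulx lcoefD lconv_tactX addrK IH ?lcoef0 ?add0r//; lia.
Qed.

Lemma iter_lmulx_inj0 l h N : (forall a, a < N -> h a = 0) ->
  (forall a, iter l lmulx h a = 0) -> forall a, h a = 0.
Proof.
move=> hN; elim: l => //= l IH h0; apply: IH; apply: (lmulx_inj0 (N := N)) h0.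
elim: l => //= l IH a aN; rewrite /lmulx !IH ?add0r; [|lia..].
exact: (biadd0r (lconv_biadditive tD)).
Qed.

Lemma iter_mulx_le l l' (f f' : int -> int -> V) : (l <= l')%N ->
  iter l (@mulx0x2 F V) f = iter l (@mulx0x2 F V) f' ->
  iter l' (@mulx0x2 F V) f = iter l' (@mulx0x2 F V) f'.
Proof. by move=> /subnK <- e; rewrite !iterD e. Qed.

(* Applying Y(u,y) to the relation and putting y = x0 + x turns it, by weak
   associativity, into the relation for the coefficients of Y(u,x0)e. *)
Lemma relation_mode (I : finType) (g : I -> laurent (laurent F)) (e w : I -> V) u m :
  \sum_i act (g i) (vY (e i) (w i)) = 0 ->
  \sum_i act (g i) (vY (mode u m (e i)) (w i)) = 0.
Proof.
move=> rel0; rewrite /mode; move: (- m - 1) => {}m.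
(* [R i a] and, below, [L i a] are the coefficients of x0^a in Y(Y(u,x0)e_i,x2)w_i and in
   Y(u,x0+x2)Y(e_i,x2)w_i. *)
pose R i a := vY (vY u (e i) a) (w i).
pose B a j (x : V) := binomF F (a + j%:Z) j *: vY u x (a + j%:Z).
have BD a j x y : B a j (x + y) = B a j x + B a j y.
  rewrite /B -scalerDr; congr (_ *: _).
  by have := vY_linearr hV u 1 x y; rewrite !scale1r => ->.
have Bt a j f x : B a j (tact f x) = tact f (B a j x).
  by rewrite /B (vY_tactr hV) -!(tactC hV) -!(tactM hV) mulrC.
pose L i a := shift_op (B a) (vY (e i) (w i)).
have LE i a b : L i a b = assocl u (e i) (w i) a b by apply: shift_opE; exact: BD.
(* The exponent of weak associativity depends on i; the maximum serves the whole finite family. *)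
have [l assoc] : exists l, forall i a, iter l lmulx (L i) a = iter l lmulx (R i) a.
  have l_ex i : exists l, iter l (@mulx0x2 F V) (assocl u (e i) (w i)) =
      iter l (@mulx0x2 F V) (assocr u (e i) (w i)) by exact: (vY_assoc hV).
  pose l i := projT1 (cid (l_ex i)); exists (\max_i l i) => i a; apply: laurentP => b.
  rewrite (iter_lmulxE _ (LE i)) (@iter_lmulxE _ (R i) (assocr u (e i) (w i)))//.
  congr (_ a b); apply: (iter_mulx_le (l := l i)); first exact: leq_bigmax.
  exact: projT2 (cid (l_ex i)).
have N_ex i : exists N, forall a, a < - N%:Z -> vY u (e i) a = 0.
  have [N eN] := lower_truncatedP _ (lcoefP (vY u (e i))).
  by exists (absz N) => a aN; apply: eN; lia.
pose N i := projT1 (cid (N_ex i)).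
(* The lower bound in x0 is that of the finitely many series Y(u,x0)e_i. *)
apply: (@iter_lmulx_inj0 l (fun a => \sum_i act (g i) (R i a)) (- (\max_i N i)%:Z)).
  move=> a aN; rewrite big1// => i _; rewrite /R.
  have -> : vY u (e i) a = 0.
    have aN' : a < - (N i)%:Z by have := leq_bigmax (F := N) i; lia.
    exact: projT2 (cid (N_ex i)) a aN'.
  rewrite (biadd0l (vY_biadditive hV)).
  exact: (biadd0r (lconv_biadditive tD)).
move=> a; rewrite iter_lmulx_lconv//.
transitivity (\sum_i act (g i) (iter l lmulx (L i) a)).
  by apply: eq_bigr => i _; rewrite assoc.
rewrite -iter_lmulx_lconv//.
(* The other side vanishes before any multiplication by x0 + x2: it is [shift_op] applied to the
   given relation. *)
suff -> : (fun a => \sum_i act (g i) (L i a)) = (fun=> 0).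
  elim: l a {assoc} => //= l IH a; rewrite /lmulx !IH add0r.
  exact: (biadd0r (lconv_biadditive tD)).
apply/funext => {}a; rewrite /L.
under eq_bigr => i _ do rewrite /act -(shift_op_lconv hV (BD a) (Bt a)).
by rewrite -(shift_op_sum (BD a)) rel0 (shift_op0 (BD a)).
Qed.
End MulX0X2.

(** * Relations between products of several operators *)

Section Coefficients.
Variables (F : fieldType) (V : vdata F) (hV : is_nonlocal_tva V).

Fixpoint vconst (n : nat) : V -> iterL n V :=
  if n is m.+1 then fun w => lconst (vconst m w) else fun w => w.

(* The head of s is the exponent of the outermost variable. *)
Fixpoint vcoef (n : nat) (s : seq int) : iterL n V -> V :=
  if n is m.+1 then fun y => vcoef (behead s) (lcoef y (head 0 s)) else fun y => y.

Fixpoint kcoef (K : fieldType) (n : nat) (s : seq int) : iterK n K -> K :=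
  if n is m.+1 then fun y => kcoef (behead s) (lcoef y (head 0 s)) else fun y => y.

Lemma vcoefD n s (x y : iterL n V) : vcoef s (x + y) = vcoef s x + vcoef s y.
Proof. by elim: n s x y => //= n IH s x y; exact: IH. Qed.

Lemma vcoef0 n s : vcoef s (0 : iterL n V) = 0.
Proof. by apply: (addrI (vcoef s (0 : iterL n V))); rewrite -vcoefD !addr0. Qed.

Lemma vcoef_sum n s (I : Type) (r : seq I) (f : I -> iterL n V) :
  vcoef s (\sum_(i <- r) f i) = \sum_(i <- r) vcoef s (f i).
Proof. exact: (big_morph _ (@vcoefD n s) (vcoef0 n s)). Qed.

Lemma kcoef0 (K : fieldType) n s : kcoef s (0 : iterK n K) = 0.
Proof. by elim: n s => //= n IH s; rewrite IH. Qed.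

Lemma vcoef_eq0 n (y : iterL n V) : (forall s, vcoef s y = 0) -> y = 0.
Proof.
elim: n y => [|n IH] y y0; first exact: (y0 [::]).
by apply: laurentP => k; apply: IH => s; exact: (y0 (k :: s)).
Qed.

Lemma kcoef_eq0 (K : fieldType) n (y : iterK n K) : (forall s, kcoef s y = 0) -> y = 0.
Proof.
elim: n y => [|n IH] y y0; first exact: (y0 [::]).
by apply: laurentP => k; apply: IH => s; exact: (y0 (k :: s)).
Qed.

Lemma vconst0 n : vconst n 0 = 0.
Proof. by elim: n => //= n ->; rewrite lconst0. Qed.

Lemma vcoef_iter_tact n s g w :
  vcoef s (@iter_tact F V n g (vconst n w)) = tact (kcoef s g) w.
Proof.
elim: n s g => //= n IH s g.
by rewrite (lconv_lconstr (iter_tact_biadditive hV n)) IH.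
Qed.

(** The vectors are constant in x_1,...,x_n, so a coefficient in these variables is taken on the
    scalars alone. This turns a relation in n+1 variables into relations in one variable. *)
Lemma vcoef_lconv n s g y b :
  vcoef s (lconv (@iter_tact F V n) g (lmap (vconst n) y) b) =
  lconv tact (lmap (kcoef s) g) y b.
Proof.
have [L1 h1] := lconv_wsum (iter_tact_biadditive hV n) g (lmap (vconst n) y) b.
have [L2 h2] := lconv_wsum (tact_biadditive hV) (lmap (kcoef s) g) y b.
rewrite (h1 (L1 + L2)%N) ?(h2 (L1 + L2)%N) ?leq_addr ?leq_addl//.
rewrite vcoef_sum; apply: eq_bigr => i _.
by rewrite !lmapE ?vconst0 ?kcoef0// vcoef_iter_tact.
Qed.

Lemma Yprod_vac n (v : 'I_n -> V) w : (forall i, v i = vac) -> Yprod v w = vconst n w.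
Proof.
elim: n v w => //= n IH v w v1; rewrite v1 (vY_vac hV); apply: laurentP => k.
rewrite lmapE ?(Yprod0 hV)// !lconstE; case: eqP => _; last exact: Yprod0.
exact: IH.
Qed.

(** Induction on n down to [relation_mode]: a last slot other than k is absorbed by taking a
    coefficient in its variable. The vectors w_i are arbitrary because this replaces them by modes
    of the last slot applied to w_i. *)
Lemma relation_Yprod n (k : 'I_n) (I : finType) (g : I -> iterK n (laurent F))
    (v : I -> 'I_n -> V) (w : I -> V) u m :
  (forall i (j : 'I_n), (j < k)%N -> v i j = vac) ->
  \sum_i iter_tact (g i) (Yprod (v i) (w i)) = 0 ->
  \sum_i iter_tact (g i) (Yprod (vupd (v i) k (mode u m (v i k))) (w i)) = 0.
Proof.
elim: n k I g v w => [|n IH] k I g v w v1; first by case: k v1.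
pose r (x : 'I_n.+1 -> V) (j : 'I_n) := x (widen_ord (leqnSn n) j).
move=> rel; have rel0 : \sum_i (iter_tact (g i) (Yprod (v i) (w i)) : laurent (iterL n V)) = 0.
  exact: rel.
have [kn|kn] := eqVneq k ord_max.
  (* The slots before the last one hold the vacuum, so the product is constant in their
     variables. *)
  have rE i z : r (vupd (v i) k z) = fun=> vac.
    apply/funext => j; have jn := ltn_ord j.
    by rewrite /r /vupd -val_eqE kn /= ltn_eqF// v1// kn.
  have rvE i : r (v i) = fun=> vac.
    by apply/funext => j; rewrite /r v1// kn /=.
  have Yv (x : 'I_n.+1 -> V) i : r x = (fun=> vac) ->
      Yprod x (w i) = lmap (vconst n) (vY (x ord_max) (w i)).
    move=> rx; apply: laurentP => b; rewrite /= !lmapE ?(Yprod0 hV) ?vconst0//.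
    rewrite -/(r x) rx; exact: Yprod_vac.
  have coef (e : I -> V) s b :
      vcoef s (lcoef (\sum_i lconv (@iter_tact F V n) (g i) (lmap (vconst n) (vY (e i) (w i)))) b) =
      (\sum_i lconv tact (lmap (kcoef s) (g i)) (vY (e i) (w i))) b.
    by rewrite !lcoef_sum vcoef_sum; apply: eq_bigr => i _; rewrite vcoef_lconv.
  apply: laurentP => b; apply: vcoef_eq0 => s.
  transitivity ((\sum_i lconv tact (lmap (kcoef s) (g i)) (vY (mode u m (v i k)) (w i))) b).
    rewrite -coef; congr (vcoef s (lcoef _ b)); apply: eq_bigr => i _.
    by rewrite Yv ?rE// /vupd kn eqxx.
  have relc : \sum_i lconv (@iter_tact F V n) (g i) (lmap (vconst n) (vY (v i k) (w i))) = 0.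
    by rewrite -[RHS]rel0; apply: eq_bigr => i _; rewrite Yv ?rvE// kn.
  by rewrite (relation_mode hV)//; apply: laurentP => {}b; rewrite -coef relc vcoef0.
have lt_kn : (k < n)%N.
  by have := ltn_ord k; rewrite ltnS leq_eqVlt => /orP[/eqP h|//]; case/eqP: kn; apply/val_inj.
pose k' := Ordinal lt_kn.
pose v' i := vupd (v i) k (mode u m (v i k)).
have rv' i : r (v' i) = vupd (r (v i)) k' (mode u m (r (v i) k')).
  apply/funext => j; rewrite /v' /r /vupd (_ : widen_ord _ k' = k)//; exact: val_inj.
have vm i : v' i ord_max = v i ord_max by rewrite /v' /vupd eq_sym (negbTE kn).
have tD := iter_tact_biadditive hV n.
apply: laurentP => b.
have L_ex i : exists L0, forall L, (L0 <= L)%N ->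
    (iter_tact (g i) (Yprod (v i) (w i)) : laurent _) b =
      wsum (@iter_tact F V n) L (g i) (lmap (Yprod (r (v i))) (vY (v i ord_max) (w i))) b /\
    (iter_tact (g i) (Yprod (v' i) (w i)) : laurent _) b =
      wsum (@iter_tact F V n) L (g i) (lmap (Yprod (r (v' i))) (vY (v i ord_max) (w i))) b.
  have [L1 h1] := lconv_wsum tD (g i) (lmap (Yprod (r (v i))) (vY (v i ord_max) (w i))) b.
  have [L2 h2] := lconv_wsum tD (g i) (lmap (Yprod (r (v' i))) (vY (v i ord_max) (w i))) b.
  exists (L1 + L2)%N => L LL; split; [rewrite -h1|rewrite -h2]; rewrite //=; try lia.
  by rewrite vm.
pose Li i := projT1 (cid (L_ex i)); pose L := \max_i Li i.
have LP i := projT2 (cid (L_ex i)) L (leq_bigmax (F := Li) i).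
(* The coefficient of x_{n+1}^b is a relation in n variables indexed by I times a window, which is
   common to the relation assumed and the one to be proved. *)
pose g' (p : I * 'I_(L.*2)) := g p.1 (p.2%:Z - L%:Z).
pose w' (p : I * 'I_(L.*2)) := vY (v p.1 ord_max) (w p.1) (b - (p.2%:Z - L%:Z)).
have E (x : I -> 'I_n.+1 -> V) :
    (forall i, (iter_tact (g i) (Yprod (x i) (w i)) : laurent _) b =
      wsum (@iter_tact F V n) L (g i) (lmap (Yprod (r (x i))) (vY (v i ord_max) (w i))) b) ->
    lcoef (\sum_i (iter_tact (g i) (Yprod (x i) (w i)) : laurent _)) b =
    \sum_p iter_tact (g' p) (Yprod (r (x p.1)) (w' p)).
  move=> h; rewrite lcoef_sum (eq_bigr _ (fun i _ => h i)) /wsum pair_big /=.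
  by apply: eq_bigr => p _; rewrite lmapE// (Yprod0 hV).
have := E v' (fun i => proj2 (LP i)); rewrite lcoef0 => ->.
transitivity (\sum_p iter_tact (g' p)
    (Yprod (vupd (r (v p.1)) k' (mode u m (r (v p.1) k'))) (w' p))).
  by apply: eq_bigr => p _; rewrite rv'.
apply: IH; first by move=> p j jk; exact: v1.
rewrite -E; last by move=> i; exact: (proj1 (LP i)).
by rewrite [X in lcoef X]rel0.
Qed.
End Coefficients.

(** * The box product *)

Definition to_linear (R : pzRingType) (M N : lmodType R) (phi : M -> N) (h : linear phi) :
    {linear M -> N} := HB.pack phi (GRing.isLinear.Build R M N *:%R phi h).

Lemma lquot_lift (R : pzRingType) (M N : lmodType R) (G : set M) (phi : {linear M -> N}) :
  (forall x, G x -> phi x = 0) ->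
  exists T : {linear lquot G -> N}, forall x, T (lpi G x) = phi x.
Proof.
move=> phiG; have TE x : phi (lrepr (lpi G x)) = phi x.
  have : lrepr (lpi G x) - x \in lspan G by apply/lpi_eqE; rewrite lreprK.
  move=> /lspanP/(_ [set y | phi y = 0]) h; apply/subr0_eq; rewrite -raddfB; apply: h => //.
  split=> [|y z|c y] /=; first exact: raddf0.
    by rewrite linearD => -> ->; rewrite addr0.
  by rewrite linearZ /= => ->; rewrite scaler0.
have Tlin : linear (fun q : lquot G => phi (lrepr q)).
  move=> c; elim/lquot_ind => x; elim/lquot_ind => y.
  by rewrite -linearP !TE linearP.
by exists (to_linear Tlin).
Qed.

Lemma malg_lift (R : comNzRingType) (K : choiceType) (N : lmodType R) (phi : K -> N) :
  exists T : {linear {malg R[K]} -> N}, forall k, T << k >> = phi k.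
Proof.
pose T (z : {malg R[K]}) := \sum_(k <- msupp z) z@_k *: phi k.
have TE (d : {fset K}) z : (msupp z `<=` d)%fset -> T z = \sum_(k <- d) z@_k *: phi k.
  move=> le; rewrite /T; apply: big_fset_incl => // x xd /mcoeff_outdom ->.
  by rewrite scale0r.
have Tlin : linear T.
  move=> c x y; pose d := (msupp x `|` msupp y)%fset.
  rewrite (TE d (c *: x + y)); last first.
    by apply: fsubset_trans (msuppD_le _ _) (fsetUSS (msuppZ_le _ _) (fsubset_refl _)).
  rewrite (TE d x) ?fsubsetUl// (TE d y) ?fsubsetUr//.
  rewrite scaler_sumr -big_split; apply: eq_bigr => k _ /=.
  by rewrite mcoeffD mcoeffZ scalerDl scalerA.
exists (to_linear Tlin) => k; rewrite [LHS](_ : _ = T << k >>)//.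
by rewrite /T msuppU oner_eq0 big_seq_fset1 mcoeffUU scale1r.
Qed.

Section Box.
Variables (F : fieldType) (V : vdata F) (n : nat).

Lemma boxpure_linear_r (v : 'I_n -> V) c f g :
  boxpure v (fstarC n c * f + g) = c *: boxpure v f + boxpure v g.
Proof.
rewrite /boxpure -linearP; congr lpi; rewrite /tpure -linearP; apply/lpi_eqE.
by apply/lspanP => S _ GS; apply: GS; right; exists v, c, f, g.
Qed.

Lemma boxpure_multilinear (v : 'I_n -> V) i c x y f :
  boxpure (vupd v i (c *: x + y)) f = c *: boxpure (vupd v i x) f + boxpure (vupd v i y) f.
Proof.
rewrite /boxpure -linearP; congr lpi; rewrite /tpure -linearP; apply/lpi_eqE.
by apply/lspanP => S _ GS; apply: GS; left; exists v, i, c, x, y, f.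
Qed.

Lemma boxpure_balanced (h : 'I_n -> laurent F) (v : 'I_n -> V) f :
  boxpure (fun i => tact (h i) (v i)) f = boxpure v ((\prod_i fstar_sub i (h i)) * f).
Proof.
apply/lpi_eqE; by apply/lspanP => S _ GS; apply: GS; exists h, v, f.
Qed.

(** The universal property of the box product; Z_n and the operators on a slot are obtained from
    it. *)
Lemma box_lift (N : lmodType F) (phi : ('I_n -> V) -> fstar F n -> N) :
  (forall v i c x y f,
    phi (vupd v i (c *: x + y)) f = c *: phi (vupd v i x) f + phi (vupd v i y) f) ->
  (forall v c f g, phi v (fstarC n c * f + g) = c *: phi v f + phi v g) ->
  (forall h v f, phi (fun i => tact (h i) (v i)) f = phi v ((\prod_i fstar_sub i (h i)) * f)) ->
  exists T : {linear box V n -> N}, forall v f, T (boxpure v f) = phi v f.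
Proof.
move=> hv hf hb; have [T0 T0E] := malg_lift (fun k : tgen V n => phi k.1 k.2).
have E0 v f : T0 (tgenerator v f) = phi v f by exact: T0E.
have [x|T1 T1E] := @lquot_lift _ _ _ (@tens_rel F V n) T0.
  case=> [[v [i [c [x0 [y [f ->]]]]]]|[v [c [f [g ->]]]]].
    move: (hv v i c x0 y f) (E0 (vupd v i (c *: x0 + y)) f) (E0 (vupd v i x0) f) (E0 (vupd v i y) f).
    move: (tgenerator _ _) (tgenerator _ _) (tgenerator _ _) => a b d e ea eb ed.
    by rewrite linearB linearP ea eb ed e subrr.
  move: (hf v c f g) (E0 v (fstarC n c * f + g)) (E0 v f) (E0 v g).
  move: (tgenerator _ _) (tgenerator _ _) (tgenerator _ _) => a b d e ea eb ed.
  by rewrite linearB linearP ea eb ed e subrr.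
have E1 v f : T1 (tpure v f) = phi v f by rewrite T1E E0.
have [x|T2 T2E] := @lquot_lift _ _ _ (@box_rel F V n) T1.
  case=> h [v [f ->]]; move: (hb h v f); move: (_ * f) => s e.
  move: (E1 (fun i => tact (h i) (v i)) f) (E1 v s).
  move: (tpure _ _) (tpure _ _) => a b ea eb.
  by rewrite linearB ea eb e subrr.
by exists T2 => v f; rewrite T2E E1.
Qed.

Lemma boxpure0 (v : 'I_n -> V) : boxpure v 0 = 0.
Proof.
have := boxpure_linear_r v 0 0 0; rewrite scale0r add0r mulr0 addr0 => h.
apply: (addrI (boxpure v 0)); rewrite addr0.
by have := boxpure_linear_r v 1 0 0; rewrite mulr0 addr0 scale1r.
Qed.

Lemma boxpureZ (v : 'I_n -> V) c f : boxpure v (fstarC n c * f) = c *: boxpure v f.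
Proof. by rewrite -[X in boxpure v X]addr0 boxpure_linear_r boxpure0 addr0. Qed.

Lemma box_sum (X : box V n) : exists (r : nat) (v : 'I_r -> 'I_n -> V) (f : 'I_r -> fstar F n),
  X = \sum_i boxpure (v i) (f i).
Proof.
elim/lquot_ind: X => x; elim/lquot_ind: x => z.
pose s := (msupp z : seq (tgen V n)); pose k (i : 'I_(size s)) := tnth (in_tuple s) i.
exists (size s), (fun i => (k i).1), (fun i => fstarC n z@_(k i) * (k i).2).
rewrite {1}[z]monalgE -/s big_tnth !raddf_sum; apply: eq_bigr => i _ /=.
have -> : << z@_(k i) *g k i >> = z@_(k i) *: << k i >>.
  by apply/malgP => j; rewrite mcoeffZ !mcoeffU; case: eqP; rewrite ?mulr1 ?mulr0.
rewrite boxpureZ /boxpure /tpure -!linearZ.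
by rewrite /tgenerator; case: (k i).
Qed.

Lemma vupd_id (v : 'I_n -> V) i : vupd v i (v i) = v.
Proof. by apply/funext => j; rewrite /vupd; case: eqP => // ->. Qed.

Lemma vupd_vupd (v : 'I_n -> V) i x y : vupd (vupd v i x) i y = vupd v i y.
Proof. by apply/funext => j; rewrite /vupd; case: eqP. Qed.

Lemma vupd_at (v : 'I_n -> V) i x : vupd v i x i = x.
Proof. by rewrite /vupd eqxx. Qed.

Lemma vupdC (v : 'I_n -> V) i j x y : i != j ->
  vupd (vupd v i x) j y = vupd (vupd v j y) i x.
Proof.
by move=> ij; apply/funext => k; rewrite /vupd; case: (eqVneq k j) => // ->;
  rewrite eq_sym (negbTE ij).
Qed.

Section SlotAction.
Variables (k : 'I_n) (a : V -> V).
Hypotheses (a_lin : linear a) (a_tact : forall f x, a (tact f x) = tact f (a x)).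

(** The box relations survive because [a] commutes with the scalar h_k of slot k and leaves the
    other slots alone. *)
Lemma slot_action : exists T : {linear box V n -> box V n},
  forall v f, T (boxpure v f) = boxpure (vupd v k (a (v k))) f.
Proof.
apply: (box_lift (phi := fun v f => boxpure (vupd v k (a (v k))) f)).
- move=> v i c x y f; have [->|ik] := eqVneq i k.
    by rewrite !vupd_vupd !vupd_at a_lin boxpure_multilinear.
  have e z : vupd v i z k = v k by rewrite /vupd eq_sym (negbTE ik).
  by rewrite !e !(vupdC _ _ _ ik) boxpure_multilinear.
- by move=> v c f g; rewrite boxpure_linear_r.
- move=> h v f; rewrite -boxpure_balanced; congr boxpure; apply/funext => j.
  by rewrite /vupd; case: eqP => // ->.
Qed.
End SlotAction.
End Box.

Section Z.
Variables (F : fieldType) (charF : [pchar F] =i pred0).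
Variables (V : vdata F) (hV : is_nonlocal_tva V) (n : nat).

(** The box relation holds because h(t) in slot i contributes h(t+x_{i+1}) by [Yprod_tactl], and
    h(x_{i+1}) in F_* is sent to the same series by [iota_shift_sub]. *)
Lemma Z_exists : exists Z : {linear box V n -> iterL n V},
  forall v f, Z (boxpure v f) = iter_tact (iota_shift f) (Yprod v vac).
Proof.
have [hB [h1 hM]] := iota_shift_morph charF n.
have hD (f g : fstar F n) : iota_shift (f + g) = iota_shift f + iota_shift g.
  exact: (raddfD (to_rmorphism (iota_shift_morph charF n))).
have tD := iter_tact_biadditive hV n.
apply: (box_lift (phi := fun v f => iter_tact (iota_shift f) (Yprod v vac))).
- move=> v i c x y f; rewrite (Yprod_multilinear hV) (proj2 tD); congr (_ + _).
  exact: (iter_tactZ hV).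
- move=> v c f g; rewrite hD (proj1 tD); congr (_ + _).
  by rewrite hM (iter_tactM hV) iota_shift_const// (iter_tact_kconst hV).
- move=> h v f; rewrite (Yprod_tactl hV) hM -(iter_tactM hV); congr (iter_tact _ _).
  rewrite [LHS]mulrC (big_morph _ hM h1); congr (_ * _); apply: eq_bigr => i _.
  by rewrite iota_shift_sub.
Qed.
End Z.

(** * Density and non-degeneracy *)

Lemma ord_recr_ind n (P : 'I_n.+1 -> Prop) :
  (forall i : 'I_n, P (widen_ord (leqnSn n) i)) -> P ord_max -> forall i, P i.
Proof.
move=> hw hm i; have := ltn_ord i; rewrite ltnS leq_eqVlt => /orP[/eqP e|lt_in].
  by rewrite (_ : i = ord_max)//; apply/val_inj.
by rewrite (_ : i = widen_ord (leqnSn n) (Ordinal lt_in))//; apply/val_inj.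
Qed.

Lemma unlift_widen n (i : 'I_n) : unlift ord_max (widen_ord (leqnSn n) i) = Some i.
Proof.
have -> : widen_ord (leqnSn n) i = lift ord_max i by apply/ord_inj; rewrite lift_max.
exact: liftK.
Qed.

Section Modes.
Variables (F : fieldType) (V : vdata F) (hV : is_nonlocal_tva V).

Lemma mode_linear (u : V) m : linear (mode u m).
Proof. by move=> c x y; rewrite /mode (vY_linearr hV). Qed.

Lemma mode_tact (u : V) m f x : mode u m (tact f x) = tact f (mode u m x).
Proof. exact: (vY_tactr hV). Qed.

Lemma mode_vac (v : V) : mode v (-1) vac = v.
Proof. exact: (vY_creation0 hV). Qed.

Lemma tactC_comm f g (x : V) : tact f (tact g x) = tact g (tact f x).
Proof. by rewrite -!(tactM hV) mulrC. Qed.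

(** The unital F-algebra generated by the modes. Composition adds one mode at a time on the left, so
    that inductions need only the effect of a single mode, as in [relation_Yprod]. *)
Inductive modeop : (V -> V) -> Prop :=
| modeop_id : modeop id
| modeop_comp u m a : modeop a -> modeop (fun w => mode u m (a w))
| modeop_lin c a b : modeop a -> modeop b -> modeop (fun w => c *: a w + b w).

Lemma modeop_linear a : modeop a -> linear a.
Proof.
elim=> [//|u m {}a _ IH|c {}a b _ IHa _ IHb] d x y; first by rewrite IH mode_linear.
by rewrite IHa IHb !scalerDr !scalerA mulrC addrACA.
Qed.

Lemma modeop_tact a : modeop a -> forall f x, a (tact f x) = tact f (a x).
Proof.
elim=> [//|u m {}a _ IH|c {}a b _ IHa _ IHb] f x; first by rewrite IH mode_tact.
by rewrite IHa IHb (tact_linear hV).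
Qed.

Hypothesis irr : is_irreducible V.
Hypothesis endV : End_eq_t V.

Lemma vac_neq0 : vac <> 0 :> V.
Proof.
case: irr => -[v v0] _ e; apply: v0; have := mode_vac v; rewrite e.
by rewrite /mode (biadd0r (vY_biadditive hV)).
Qed.

(* The values at x of the operators that vanish on a given family form a submodule. *)
Lemma modeop_orbit r (e : 'I_r -> V) x a0 : modeop a0 -> (forall i, a0 (e i) = 0) ->
  a0 x <> 0 -> forall y, exists a, [/\ modeop a, forall i, a (e i) = 0 & a x = y].
Proof.
move=> a0P a0e a0x y; pose S : set V :=
  [set y | exists a, [/\ modeop a, forall i, a (e i) = 0 & a x = y]].
have SS : is_submod S.
  have lin c z t : S z -> S t -> S (c *: z + t).
    move=> [a [aP ae az]] [b [bP be bt]]; exists (fun w => c *: a w + b w).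
    split=> [|i|]; first exact: modeop_lin.
      by rewrite ae be scaler0 addr0.
    by rewrite az bt.
  have S0 : S 0.
    by have := lin (-1) (a0 x) (a0 x); rewrite scaleN1r addNr; apply; exists a0.
  split=> // [z t Sz St|c z Sz]; first by rewrite -[z]scale1r; exact: lin.
  by rewrite -[c *: z]addr0; exact: lin.
have [|S0|ST] := (proj2 irr) S SS.
- move=> u m w [a [aP ae aw]]; exists (fun w => mode u m (a w)); split.
  + exact: modeop_comp.
  + by move=> i; rewrite ae /mode (biadd0r (vY_biadditive hV)).
  + by rewrite aw.
- have : S (a0 x) by exists a0.
  by rewrite S0 => /a0x.
- by have : S y by rewrite ST.
Qed.

(* Jacobson density over the commutant F((t)). *)
Lemma density_span r (e : 'I_r -> V) x :
  (forall a, modeop a -> (forall i, a (e i) = 0) -> a x = 0) ->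
  exists h : 'I_r -> laurent F, x = \sum_i tact (h i) (e i).
Proof.
elim: r e x => [|r IH] e x H.
  by exists (fun=> 0); rewrite big_ord0; apply: (H id); [exact: modeop_id|case].
pose e' i := e (widen_ord (leqnSn r) i).
have [H'|/existsNP[a0 /not_implyP[a0P /not_implyP[a0e a0r]]]] :=
    pselect (forall a, modeop a -> (forall i, a (e' i) = 0) -> a (e ord_max) = 0).
  have [a aP ae|h ->] := IH e' x; first by apply: H => //; apply: ord_recr_ind => //; exact: H'.
  exists (fun i => if unlift ord_max i is Some j then h j else 0).
  rewrite big_ord_recr /= unlift_none (biadd0l (tact_biadditive hV)) addr0.
  by apply: eq_bigr => i _; rewrite unlift_widen.
(* [A y] kills e' and sends the last vector to y. Its value at x is independent of the choice
   ([uniq]), so y |-> A y x commutes with the modes and is multiplication by some f(t). Then x minus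
   f times the last vector satisfies the hypothesis for e'. *)
have orb := modeop_orbit a0P a0e a0r.
pose A y := projT1 (cid (orb y)).
have AP y : [/\ modeop (A y), forall i, A y (e' i) = 0 & A y (e ord_max) = y].
  exact: projT2 (cid (orb y)).
have uniq a b : modeop a -> modeop b -> (forall i, a (e' i) = 0) ->
    (forall i, b (e' i) = 0) -> a (e ord_max) = b (e ord_max) -> a x = b x.
  move=> aP bP ae be ab; have := H (fun w => (-1) *: b w + a w).
  rewrite scaleN1r => h; apply/eqP; rewrite -subr_eq0 addrC; apply/eqP/h.
    exact: modeop_lin.
  by apply: ord_recr_ind => [i|]; rewrite scaleN1r ?ae ?be ?ab ?oppr0 ?addr0 ?addNr// ae be subrr.
have psi_lin : linear (fun y => A y x).
  move=> c y z; have [yP ye yr] := AP y; have [zP ze zr] := AP z.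
  have [sP se sr] := AP (c *: y + z).
  apply: (uniq _ (fun w => c *: A y w + A z w)) => //; first exact: modeop_lin.
    by move=> i; rewrite ye ze scaler0 addr0.
  by rewrite sr yr zr.
have psi_mode u m y : A (mode u m y) x = mode u m (A y x).
  have [yP ye yr] := AP y; have [sP se sr] := AP (mode u m y).
  apply: (uniq _ (fun w => mode u m (A y w))) => //; first exact: modeop_comp.
    by move=> i; rewrite ye /mode (biadd0r (vY_biadditive hV)).
  by rewrite sr yr.
have [f fE] := endV (psi := to_linear psi_lin) psi_mode.
have [a aP ae|h hE] := IH e' (x - tact f (e ord_max)).
  have aB : a (x - tact f (e ord_max)) = a x - tact f (a (e ord_max)).
    rewrite -scaleN1r addrC (modeop_linear aP) (modeop_tact aP) scaleN1r; exact: addrC.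
  have [sP se sr] := AP (a (e ord_max)).
  by rewrite aB -fE /= -(uniq a _ aP sP ae se) ?subrr.
exists (fun i => if unlift ord_max i is Some j then h j else f).
rewrite big_ord_recr /= unlift_none -[LHS](subrK (tact f (e ord_max))) hE; congr (_ + _).
by apply: eq_bigr => i _; rewrite unlift_widen.
Qed.

(** The dichotomy of the elimination: if some operator kills the e_i but not x, irreducibility moves
    its value at x to the vacuum. *)
Lemma density r (e : 'I_r -> V) x :
  (exists h : 'I_r -> laurent F, x = \sum_i tact (h i) (e i)) \/
  (exists a, [/\ modeop a, forall i, a (e i) = 0 & a x = vac]).
Proof.
have [h|/existsNP[a /not_implyP[aP /not_implyP[ae ax]]]] :=
    pselect (forall a, modeop a -> (forall i, a (e i) = 0) -> a x = 0).
  by left; exact: density_span.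
by right; exact: (modeop_orbit aP ae ax).
Qed.
End Modes.

(** * Operators on one slot and the kernel of Z_n *)

Section Slots.
Variables (F : fieldType) (V : vdata F) (hV : is_nonlocal_tva V) (n : nat).

(** Slots count from 0, so k = 0 gives all of the box product and k = n only the classes of 1 x ...
    x 1 box f. *)
Definition vac_below (k : nat) (X : box V n) : Prop :=
  exists (r : nat) (v : 'I_r -> 'I_n -> V) (f : 'I_r -> fstar F n),
    (forall i (j : 'I_n), (j < k)%N -> v i j = vac) /\ X = \sum_i boxpure (v i) (f i).

Lemma vac_belowD k X Y : vac_below k X -> vac_below k Y -> vac_below k (X + Y).
Proof.
move=> [r [v [f [v1 ->]]]] [s [w [g [w1 ->]]]].
exists (r + s)%N, (fun i : 'I_(r + s) => match fintype.split i with inl a => v a | inr b => w b end),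
  (fun i : 'I_(r + s) => match fintype.split i with inl a => f a | inr b => g b end); split.
  by move=> i j jk; case: fintype.split => a; [exact: v1|exact: w1].
have sl i : fintype.split (lshift s i) = inl i :> 'I_r + 'I_s := unsplitK (inl i).
have sr i : fintype.split (rshift r i) = inr i :> 'I_r + 'I_s := unsplitK (inr i).
rewrite big_split_ord; apply: f_equal2; apply: eq_bigr => i _.
  by rewrite sl.
by rewrite sr.
Qed.

Lemma vac_below_pure k v f : (forall j : 'I_n, (j < k)%N -> v j = vac) ->
  vac_below k (boxpure v f).
Proof. by move=> v1; exists 1%N, (fun=> v), (fun=> f); rewrite big_ord1; split=> // i. Qed.

Lemma vac_below0 k : vac_below k 0.
Proof. by rewrite -(boxpure0 (fun=> vac)); exact: vac_below_pure. Qed.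

Lemma vac_below_sum k (I : Type) (r : seq I) (X : I -> box V n) :
  (forall i, vac_below k (X i)) -> vac_below k (\sum_(i <- r) X i).
Proof. by move=> h; elim/big_ind: _ => //; [exact: vac_below0|exact: vac_belowD]. Qed.

Definition slot_spec (k : 'I_n) (a : V -> V) (T : {linear box V n -> box V n}) :=
  forall v f, T (boxpure v f) = boxpure (vupd v k (a (v k))) f.

Lemma boxpure_slotD (v : 'I_n -> V) k x y f :
  boxpure (vupd v k (x + y)) f = boxpure (vupd v k x) f + boxpure (vupd v k y) f.
Proof. by have := boxpure_multilinear v k 1 x y f; rewrite !scale1r. Qed.

Lemma boxpure_slot0 (v : 'I_n -> V) k f : boxpure (vupd v k 0) f = 0.
Proof. by apply: (addrI (boxpure (vupd v k 0) f)); rewrite -boxpure_slotD !addr0. Qed.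

Lemma boxpure_slot_sum (v : 'I_n -> V) k f (I : Type) (r : seq I) (x : I -> V) :
  boxpure (vupd v k (\sum_(i <- r) x i)) f = \sum_(i <- r) boxpure (vupd v k (x i)) f.
Proof.
exact: (big_morph (fun y => boxpure (vupd v k y) f)
  (fun x y => boxpure_slotD v k x y f) (boxpure_slot0 v k f)).
Qed.

Variable k : 'I_n.

(* On an element with the vacuum in slot k, a slot operator only depends on its
   value at the vacuum. *)
Lemma slot_sum r (b : 'I_r -> V -> V) (Tb : 'I_r -> {linear box V n -> box V n}) a T X :
  (forall i, slot_spec k (b i) (Tb i)) -> slot_spec k a T ->
  a vac = \sum_i b i vac -> vac_below k.+1 X -> T X = \sum_i Tb i X.
Proof.
move=> Tb_spec T_spec ab [s [v [f [v1 ->]]]]; rewrite linear_sum.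
transitivity (\sum_j \sum_i Tb i (boxpure (v j) (f j))).
  apply: eq_bigr => j _; rewrite T_spec v1// ab boxpure_slot_sum.
  by apply: eq_bigr => i _; rewrite Tb_spec v1.
by rewrite exchange_big; apply: eq_bigr => i _; rewrite linear_sum.
Qed.

(** The box relation turns f(t)1 in slot k into the factor f(x_{k+1}), which restores the vacuum
    there. *)
Lemma vac_below_tact f T X : slot_spec k (tact f) T ->
  vac_below k.+1 X -> vac_below k.+1 (T X).
Proof.
move=> Tf [r [v [g [v1 ->]]]]; rewrite linear_sum; apply: vac_below_sum => i.
rewrite Tf; pose h (j : 'I_n) : laurent F := if j == k then f else 1.
have -> : vupd (v i) k (tact f (v i k)) = fun j => tact (h j) (v i j).
  by apply/funext => j; rewrite /vupd /h; case: eqP => [->//|_]; rewrite (tact1 hV).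
by rewrite boxpure_balanced; apply: vac_below_pure; exact: v1.
Qed.

Lemma slot_exists a : modeop a -> exists T, slot_spec k a T.
Proof. by move=> aP; apply: slot_action; [exact: modeop_linear|exact: modeop_tact]. Qed.

Lemma slot_tact_exists f : exists T, slot_spec k (tact f) T.
Proof. by apply: slot_action; [exact: (tact_linear hV)|move=> g x; exact: tactC_comm]. Qed.

Variable Z : {linear box V n -> iterL n V}.
Hypothesis ZE : forall v f, Z (boxpure v f) = iter_tact (iota_shift f) (Yprod v vac).

(** Induction on the operator. The shape of T X is carried along with Z (T X) = 0, since
    [relation_Yprod] needs the vacuum before slot k again for the next mode. *)
Lemma ker_modeop a T X : modeop a -> slot_spec k a T -> vac_below k X -> Z X = 0 ->
  vac_below k (T X) /\ Z (T X) = 0.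
Proof.
move=> aP; elim: aP T X => [|u m {}a aP IH|c {}a b aP IHa bP IHb] T X T_spec Xk ZX0.
- have -> : T X = X; last by [].
  have [r [v [f [v1 ->]]]] := Xk; rewrite linear_sum; apply: eq_bigr => i _.
  by rewrite T_spec vupd_id.
- have [Ta Ta_spec] := slot_exists aP; have [] := IH Ta X Ta_spec Xk ZX0.
  move=> [r [v [f [v1 TaX]]]] ZTa.
  have TX : T X = \sum_i boxpure (vupd (v i) k (mode u m (v i k))) (f i).
    have modeP := modeop_comp u m (modeop_id V); have [Tm Tm_spec] := slot_exists modeP.
    transitivity (Tm (Ta X)).
      have [s [w [g ->]]] := box_sum X; rewrite !linear_sum; apply: eq_bigr => i _.
      by rewrite T_spec Ta_spec Tm_spec vupd_vupd vupd_at.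
    by rewrite TaX linear_sum; apply: eq_bigr => i _; rewrite Tm_spec.
  rewrite TX; split.
    exists r, (fun i => vupd (v i) k (mode u m (v i k))), f; split=> // i j jk.
    by rewrite /vupd ifN ?v1// -val_eqE ltn_eqF.
  rewrite linear_sum; under eq_bigr do rewrite ZE.
  apply: (relation_Yprod hV) => //; rewrite -[RHS]ZTa TaX linear_sum.
  by apply: eq_bigr => i _; rewrite ZE.
- have [Ta Ta_spec] := slot_exists aP; have [Tb Tb_spec] := slot_exists bP.
  have [aX Za] := IHa Ta X Ta_spec Xk ZX0; have [bX Zb] := IHb Tb X Tb_spec Xk ZX0.
  have -> : T X = c *: Ta X + Tb X.
    have [s [w [g ->]]] := box_sum X; rewrite !linear_sum -big_split.
    apply: eq_bigr => i _ /=.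
    by rewrite T_spec Ta_spec Tb_spec boxpure_multilinear.
  split; last by rewrite linearD linearZ /= Za Zb scaler0 addr0.
  apply: vac_belowD => //; have [s [w [g [w1 ->]]]] := aX.
  rewrite scaler_sumr; apply: vac_below_sum => i; rewrite -boxpureZ.
  by apply: vac_below_pure; exact: w1.
Qed.
End Slots.

Section Nondegenerate.
Variables (F : fieldType) (charF : [pchar F] =i pred0).
Variables (V : vdata F) (hV : is_nonlocal_tva V).
Hypotheses (irr : is_irreducible V) (endV : End_eq_t V).
Variable n : nat.
Variable Z : {linear box V n -> iterL n V}.
Hypothesis ZE : forall v f, Z (boxpure v f) = iter_tact (iota_shift f) (Yprod v vac).

(** The terms collapse to a single fraction g, and each coefficient of its image is some c in F((t))
    with c 1 = 0. As F((t)) is a field and the vacuum is nonzero, c = 0, and [iota_shift] is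
    injective. *)
Lemma ker_vac_below_n X : vac_below n X -> Z X = 0 -> X = 0.
Proof.
move=> [r [v [f [v1 ->]]]] Z0; pose w : 'I_n -> V := fun=> vac.
have vE i : v i = w by apply/funext => j; apply: v1.
have sumE : \sum_i boxpure (v i) (f i) = boxpure w (\sum_i f i).
  have wD g h : boxpure w (g + h) = boxpure w g + boxpure w h.
    have fC1 : fstarC n (1 : F) = 1 by apply/val_inj; rewrite /= psnC1 tofrac1.
    by have := boxpure_linear_r w 1 g h; rewrite fC1 mul1r scale1r.
  by rewrite (big_morph _ wD (boxpure0 w)); apply: eq_bigr => i _; rewrite vE.
rewrite sumE in Z0 *; set g := \sum_i f i in Z0 *.
suff -> : g = 0 by exact: boxpure0.
apply: (iota_shift_inj charF).
have iota0 : iota_shift (0 : fstar F n) = 0.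
  exact: (raddf0 (to_rmorphism (iota_shift_morph charF n))).
rewrite iota0; apply: kcoef_eq0 => s; set c := kcoef _ _.
have c0 : tact c vac = 0 :> V.
  by rewrite -(vcoef_iter_tact hV) -(Yprod_vac hV (v := w))// -ZE Z0 vcoef0.
apply/eqP/negPn/negP => cn0; apply: (vac_neq0 hV irr).
by rewrite -(tact1 hV vac) -(mulVf cn0) (tactM hV) c0 (biadd0r (tact_biadditive hV)).
Qed.

(** Elimination on the number of terms. Since e_{-1} 1 = e, the slot operator [A e] of the mode
    e_{-1} inserts e into a slot k that holds the vacuum, so elements take the form of a sum of
    [A e_i] applied to X_i. *)
Lemma ker_vac_below_step (k : 'I_n) :
  (forall X, vac_below k.+1 X -> Z X = 0 -> X = 0) ->
  forall X, vac_below k X -> Z X = 0 -> X = 0.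
Proof.
move=> IHk.
have insP (e : V) : modeop (mode e (-1)) by exact: (modeop_comp e (-1) (modeop_id V)).
pose A e := projT1 (cid (slot_exists hV k (insP e))).
have AE e : slot_spec k (mode e (-1)) (A e) := projT2 (cid (slot_exists hV k (insP e))).
pose Tt f := projT1 (cid (slot_tact_exists hV k f)).
have TtE f : slot_spec k (tact f) (Tt f) := projT2 (cid (slot_tact_exists hV k f)).
have AX e X : vac_below k.+1 X -> vac_below k (A e X).
  move=> [r [v [f [v1 ->]]]]; rewrite linear_sum; apply: vac_below_sum => i; rewrite AE.
  by apply: vac_below_pure => j jk; rewrite /vupd -val_eqE ltn_eqF// v1// ltnW.
have main r (e : 'I_r -> V) (X : 'I_r -> box V n) : (forall i, vac_below k.+1 (X i)) ->
    Z (\sum_i A (e i) (X i)) = 0 -> \sum_i A (e i) (X i) = 0.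
  elim: r e X => [|r IH] e X Xk Z0; first by rewrite big_ord0.
  pose w i := widen_ord (leqnSn r) i.
  have [[h hE]|[a [aP ae ar]]] := density hV irr endV (fun i => e (w i)) (e ord_max).
    (* The last vector is a combination of the others; its coefficients move into the X_i, and one
       term disappears. *)
    have sumE : \sum_i A (e i) (X i) =
        \sum_(i < r) A (e (w i)) (X (w i) + Tt (h i) (X ord_max)).
      rewrite big_ord_recr /= [in RHS](eq_bigr _ (fun i _ => linearD _ _ _)) big_split.
      congr (_ + _).
      apply: (slot_sum (b := fun i => mode (e (w i)) (-1) \o tact (h i))
        (Tb := fun i => A (e (w i)) \o Tt (h i)) _ (AE _)) => //.
        by move=> i v f /=; rewrite TtE AE vupd_vupd vupd_at.
      rewrite (mode_vac hV) hE; apply: eq_bigr => i _ /=.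
      by rewrite (mode_tact hV) (mode_vac hV).
    rewrite sumE in Z0 *; apply: IH Z0 => i; apply: vac_belowD => //.
    exact: vac_below_tact.
  (* The operator [a] kills every e_i but the last and sends the last to the vacuum, so T maps the
     sum to [X ord_max], which is therefore in the kernel and zero by [IHk]. *)
  have [T T_spec] := slot_exists hV k aP.
  have TA i : T (A (e i) (X i)) = if i == ord_max then X ord_max else 0.
    have [->|i_max] := eqVneq i ord_max.
      have [r' [v [f [v1 ->]]]] := Xk ord_max; rewrite !linear_sum; apply: eq_bigr => j _.
      by rewrite AE T_spec vupd_vupd vupd_at v1// (mode_vac hV) ar -(v1 j k) ?vupd_id.
    have [r' [v [f [v1 ->]]]] := Xk i; rewrite !linear_sum big1// => j _.
    rewrite AE T_spec vupd_vupd vupd_at v1// (mode_vac hV).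
    suff -> : a (e i) = 0 by exact: boxpure_slot0.
    by move: i i_max {r' v f v1 j}; apply: ord_recr_ind => [i _|/eqP//]; exact: ae.
  have [|_ ZT] := ker_modeop hV ZE aP T_spec _ Z0.
    by apply: vac_below_sum => i; exact: AX.
  have Xr0 : X ord_max = 0.
    apply: IHk => //; rewrite -[RHS]ZT linear_sum; congr (Z _).
    by rewrite (bigD1 ord_max)//= TA eqxx big1 ?addr0// => i /negbTE i0; rewrite TA i0.
  rewrite big_ord_recr /= Xr0 linear0 addr0 in Z0 *.
  exact: IH Z0.
move=> X [r [v [f [v1 ->]]]] Z0.
have sumE : \sum_i boxpure (v i) (f i) = \sum_i A (v i k) (boxpure (vupd (v i) k vac) (f i)).
  by apply: eq_bigr => i _; rewrite AE vupd_vupd vupd_at (mode_vac hV) vupd_id.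
rewrite sumE in Z0 *; apply: main Z0 => i; apply: vac_below_pure => j.
rewrite ltnS leq_eqVlt /vupd => /orP[jk|jk]; first by rewrite ifT.
by rewrite -val_eqE ltn_eqF// v1.
Qed.

Lemma Z_injective : injective Z.
Proof.
have ker d k : (k + d)%N = n -> forall X, vac_below k X -> Z X = 0 -> X = 0.
  elim: d k => [|d IH] k kd; first by move: kd; rewrite addn0 => ->; exact: ker_vac_below_n.
  have kn : (k < n)%N by rewrite -kd addnS ltnS leq_addr.
  by apply: (@ker_vac_below_step (Ordinal kn)); apply: IH; rewrite addSn -addnS.
move=> X Y XY; apply/subr0_eq/(ker n 0%N) => //; last by rewrite linearB XY subrr.
by have [r [v [f ->]]] := box_sum (X - Y); exists r, v, f.
Qed.
End Nondegenerate.

(** * Passage from the graded algebra *)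

Section Graded.
Variables (F : fieldType) (V : vdata F) (hV : is_nonlocal_tva V).
Variables (Fil : int -> submod V) (hFil : is_filtration Fil).
Local Notation gr := (gr Fil).

Lemma fil0 p : Fil p 0. Proof. exact: submod0 (ssetP _). Qed.

Lemma filD p x y : Fil p x -> Fil p y -> Fil p (x + y).
Proof. exact: submodD (ssetP _) _ _. Qed.

Lemma filZ p c x : Fil p x -> Fil p (c *: x).
Proof. exact: submodZ (ssetP _) _ _. Qed.

Lemma filN p x : Fil p x -> Fil p (- x).
Proof. by rewrite -scaleN1r; exact: filZ. Qed.

Lemma filB p x y : Fil p x -> Fil p y -> Fil p (x - y).
Proof. by move=> px py; apply: filD => //; exact: filN. Qed.

Lemma filBC p x y : Fil p (x - y) -> Fil p (y - x).
Proof. by move=> /filN; rewrite opprB. Qed.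

Lemma filB_trans p x y z : Fil p (x - y) -> Fil p (y - z) -> Fil p (x - z).
Proof. by move=> xy /(filD xy); rewrite addrA subrK. Qed.

(** [gr_repr] picks arbitrary representatives: it is not additive and need not vanish on 0.
    Identities in Gr are therefore tested modulo the next lower step of the filtration. *)
Lemma gr_ext (a b : gr) :
  (forall p, Fil (p - 1) (gr_repr a p - gr_repr b p)) -> a = b.
Proof.
move=> ab; apply/val_inj/functional_extensionality_dep => p /=.
by rewrite -[LHS]lreprK -[RHS]lreprK; apply/gr_lpiE/ab.
Qed.

Lemma gr_repr_linear c (a b : gr) p :
  Fil (p - 1) (gr_repr (c *: a + b) p - (c *: gr_repr a p + gr_repr b p)).
Proof.
have -> : c *: gr_repr a p + gr_repr b p =
    val (c *: lrepr (dcoef a p) + lrepr (dcoef b p)) by rewrite linearP.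
by apply/gr_lpiE; rewrite lreprK linearP /= !lreprK.
Qed.

Lemma gr_finite (a : gr) : exists s : seq int, uniq s /\
  forall m, m \notin s -> Fil (m - 1) (gr_repr a m).
Proof.
have /dfiniteP/finite_seqP[s sE] := dcoefP a; exists (undup s); split=> [|m]; first exact: undup_uniq.
rewrite mem_undup => ms; have /eqP a0 : dcoef a m == 0.
  by apply: contraNT ms => am; have : [set i | dcoef a i != 0] m by []; rewrite sE.
have -> : gr_repr a m = gr_repr a m - val (0 : subl (Fil m)) by rewrite [val _]raddf0 subr0.
by apply/gr_lpiE; rewrite lreprK raddf0.
Qed.

Lemma modeBr k (u v w : V) : mode u k (v - w) = mode u k v - mode u k w.
Proof.
by rewrite [X in mode u k X]addrC -scaleN1r (mode_linear hV) scaleN1r addrC.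
Qed.

Lemma gr_mode_sum (a b : gr) k sA sB : uniq sA -> uniq sB ->
  (forall m, m \notin sA -> Fil (m - 1) (gr_repr a m)) ->
  (forall n, n \notin sB -> Fil (n - 1) (gr_repr b n)) ->
  gr_mode a k b = \sum_(m <- sA) \sum_(n <- sB)
    gr_in Fil (m + n - 2 * k - 2) (mode (gr_repr a m) k (gr_repr b n)).
Proof.
move=> uA uB aA bB; rewrite /gr_mode.
rewrite -(@fsbig_widen _ _ _ _ [set` sA])//; last first.
  move=> m [_ /= /negP mA]; rewrite fsbig1// => n _; apply: (gr_in_lower hFil).
  have := fil_mode hFil k (aA m mA) (gr_repr_fil b n); by congr (Fil _ _); lia.
rewrite -fsbig_seq//; apply: eq_bigr => m _.
rewrite -(@fsbig_widen _ _ _ _ [set` sB])//; last first.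
  move=> n [_ /= /negP nB]; apply: (gr_in_lower hFil).
  have := fil_mode hFil k (gr_repr_fil a m) (bB n nB); by congr (Fil _ _); lia.
by rewrite -fsbig_seq.
Qed.

(** The field of Gr is built with [lof], which gives 0 on series that are not truncated. Here only
    finitely many pairs of components contribute, so the lower bounds of their series have a common
    one. *)
Lemma Gr_mode (a b : Gr Fil) k : mode a k b = gr_mode a k b.
Proof.
have [sA [uA aA]] := gr_finite a; have [sB [uB bB]] := gr_finite b.
have N_ex m n : exists N, forall e, e < - N%:Z -> vY (gr_repr a m) (gr_repr b n) e = 0.
  have [N eN] := lower_truncatedP _ (lcoefP (vY (gr_repr a m) (gr_repr b n))).
  by exists (absz N) => e; move=> h; apply: eN; lia.
pose N m n := projT1 (cid (N_ex m n)).
pose B := \max_(m <- sA) \max_(n <- sB) N m n.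
rewrite /mode /= (@lofE _ _ (- B%:Z)) => [|e eB].
  by rewrite (_ : - (- k - 1) - 1 = k)//; lia.
rewrite (gr_mode_sum _ uA uB aA bB) big_seq big1// => m mA; rewrite big_seq big1// => n nB.
rewrite /mode (_ : - (- e - 1) - 1 = e); last by lia.
suff -> : vY (gr_repr a m) (gr_repr b n) e = 0 by exact: gr_in0.
apply: (projT2 (cid (N_ex m n))); apply: (lt_le_trans eB); rewrite lerN2 lez_nat.
apply: (@leq_trans (\max_(n <- sB) N m n)).
  exact: leq_bigmax_seq.
exact: (leq_bigmax_seq (F := fun m => \max_(n <- sB) N m n)).
Qed.

Lemma gr_in_inj p x : Fil p x -> gr_in Fil p x = 0 -> Fil (p - 1) x.
Proof.
move=> px x0; have := gr_repr_in px; rewrite x0 -(gr_in0 Fil p) => /filBC.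
by move/filD/(_ (gr_repr_in (fil0 p))); rewrite subr0 subrK.
Qed.

(** The union property gives a level to start from, and boundedness below ends the descent after
    finitely many steps. *)
Lemma fil_descend (P : V -> Prop) : (forall p x, Fil p x -> P x -> Fil (p - 1) x) ->
  forall x, P x -> x = 0.
Proof.
move=> desc x Px; have [p px] := fil_union hFil x; have [N bN] := fil_bounded hFil.
suff H d : Fil (p - d%:Z) x by apply: (bN (p - (absz (p - N)).+1%:Z)); [lia|exact: H].
elim: d => [|d IH]; first by rewrite subr0.
by have := desc _ _ IH Px; congr (Fil _ _); lia.
Qed.

Hypothesis irr : is_irreducible (Gr Fil).

Lemma irreducible_of_graded : is_irreducible V.
Proof.
split=> [|S Ssub Smode].
  apply: contrapT => /forallNP V0; have [[a a0] _] := irr; apply: a0; apply: gr_ext => p.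
  by rewrite (contrapT (V0 (gr_repr a p - _))); exact: fil0.
(* The associated graded of S: each component is the class of an element of S in the same step of
   the filtration. *)
pose GS : set (Gr Fil) := [set b | forall m, exists s, [/\ S s, Fil m s &
  Fil (m - 1) (gr_repr b m - s)]].
have [S0 SD SZ] := Ssub.
have GS0 : GS 0.
  move=> m; exists 0; split=> //; first exact: fil0.
  by rewrite -(gr_in0 Fil m); apply: gr_repr_in; exact: fil0.
have GSlin c x y : GS x -> GS y -> GS (c *: x + y).
  move=> Gx Gy m; have [s [Ss ms xs]] := Gx m; have [t [St mt yt]] := Gy m.
  exists (c *: s + t); split; [by auto|by apply: filD => //; exact: filZ|].
  apply: filB_trans (gr_repr_linear _ _ _ _) _; rewrite opprD addrACA -scalerBr.
  by apply: filD => //; exact: filZ.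
have GSsub : is_submod GS.
  split=> // [x y Gx Gy|c x Gx]; first by rewrite -[x]scale1r; exact: GSlin.
  by rewrite -[c *: x]addr0; exact: GSlin.
have GSin p s : S s -> Fil p s -> GS (gr_in Fil p s).
  move=> Ss ps m; have [->|mp] := eqVneq m p; first by exists s; split=> //; exact: gr_repr_in.
  by exists 0; split=> //; [exact: fil0|rewrite subr0; exact: gr_repr_out].
have GSmode a k b : GS b -> GS (mode a k b).
  move=> Gb; rewrite Gr_mode; have [sA [uA aA]] := gr_finite a.
  have [sB [uB bB]] := gr_finite b; rewrite (gr_mode_sum _ uA uB aA bB).
  elim/big_ind: _ => [|x y Gx Gy|m _]; [exact: GS0|exact: submodD GSsub _ _ Gx Gy|].
  elim/big_ind: _ => [|x y Gx Gy|n _]; [exact: GS0|exact: submodD GSsub _ _ Gx Gy|].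
  have [s [Ss ns bs]] := Gb n.
  have am := gr_repr_fil a m; have bn := gr_repr_fil b n.
  rewrite (gr_in_eq (w := mode (gr_repr a m) k s)).
  - by apply: GSin; [exact: Smode|exact: fil_mode].
  - exact: fil_mode.
  - exact: fil_mode.
  - rewrite -modeBr; have := fil_mode hFil k am bs; by congr (Fil _ _); lia.
have [GS_0|GS_T] := (proj2 irr) GS GSsub GSmode.
  left; apply/seteqP; split=> [s Ss|_ ->//] /=.
  apply: (fil_descend (P := S)) Ss => p x px Sx; apply: gr_in_inj => //.
  by have := GSin p x Sx px; rewrite GS_0.
right; apply/seteqP; split=> // v _; have [N bN] := fil_bounded hFil.
(* When the graded submodule is everything, x differs from an element of S by an element one step
   lower. *)
have H d p x : p < N + d%:Z -> Fil p x -> S x.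
  elim: d p x => [|d IH] p x pN px; first by rewrite (bN p _ x px)//; lia.
  have : GS (gr_in Fil p x) by rewrite GS_T.
  move=> /(_ p)[s [Ss ps xs]]; rewrite -[x](subrK s); apply: SD => //.
  apply: (IH (p - 1)); first by lia.
  by apply: filB_trans xs; apply: filBC; exact: gr_repr_in.
have [p pv] := fil_union hFil v; apply: (H (absz (p - N)).+1 p) => //; lia.
Qed.

(** * The graded map of an endomorphism of degree p *)

Section ShiftEndo.
Variables (psi : {linear V -> V}) (p : int).
Hypothesis psi_fil : forall n x, Fil n x -> Fil (n + p) (psi x).
Hypothesis psi_mode : forall v n w, psi (mode v n w) = mode v n (psi w).

(** Component q comes from component q - p. The default 0 of [insubd] never occurs, by
    [psi_repr]. *)
Let comp (b : gr) : dprod (gr_piece Fil) :=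
  fun q => lpi _ (insubd 0 (psi (gr_repr b (q - p))) : subl (Fil q)).

Let psi_repr (b : gr) q : Fil q (psi (gr_repr b (q - p))).
Proof. by have := psi_fil (gr_repr_fil b (q - p)); rewrite subrK. Qed.

Let comp_eq0 (b : gr) q : Fil (q - p - 1) (gr_repr b (q - p)) -> comp b q = 0.
Proof.
move=> b0; transitivity (lpi [set x : subl (Fil q) | Fil (q - 1) (val x)] 0); last exact: raddf0.
apply/gr_lpiE.
rewrite [val 0]raddf0 subr0 insubdK; last exact/sub_predP/psi_repr.
by have := psi_fil b0; congr (Fil _ _); lia.
Qed.

Let comp_finite (b : gr) : comp b \in @dfinite _ _ (gr_piece Fil).
Proof.
have [s [us bs]] := gr_finite b; apply/dfiniteP.
apply: (sub_finite_set _ (finite_seq [seq m + p | m <- s])) => q /= bq.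
apply/negPn/negP => qs; case/eqP: bq; apply: comp_eq0; apply: bs.
by apply: contra qs => qs; apply/mapP; exists (q - p) => //; rewrite subrK.
Qed.

Definition gr_endo (b : gr) : gr := DSum (comp_finite b).

Lemma gr_endo_repr b q : Fil (q - 1) (gr_repr (gr_endo b) q - psi (gr_repr b (q - p))).
Proof.
have <- : val (insubd 0 (psi (gr_repr b (q - p))) : subl (Fil q)) = psi (gr_repr b (q - p)).
  by rewrite insubdK//; exact/sub_predP/psi_repr.
by apply/gr_lpiE; rewrite lreprK.
Qed.

Lemma gr_endo_linear : linear gr_endo.
Proof.
move=> c x y; apply: gr_ext => q.
apply: filB_trans (gr_endo_repr _ _) _; apply: filBC.
apply: filB_trans (gr_repr_linear _ _ _ _) _.
apply: (filB_trans (y := c *: psi (gr_repr x (q - p)) + psi (gr_repr y (q - p)))).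
  rewrite opprD addrACA -scalerBr; apply: filD; last exact: gr_endo_repr.
  by apply: filZ; exact: gr_endo_repr.
rewrite -linearP; apply: filBC; rewrite -linearB.
by have := psi_fil (gr_repr_linear c x y (q - p)); congr (Fil _ _); lia.
Qed.

Lemma gr_endo_in n x : Fil n x -> gr_endo (gr_in Fil n x) = gr_in Fil (n + p) (psi x).
Proof.
move=> nx; have npx := psi_fil nx; apply: gr_ext => q.
apply: filB_trans (gr_endo_repr _ _) _; have [->|qn] := eqVneq q (n + p).
  apply: (filB_trans (y := psi x)); last by apply: filBC; exact: gr_repr_in.
  rewrite addrK -linearB; have := psi_fil (gr_repr_in nx); by congr (Fil _ _); lia.
apply: filB; last exact: gr_repr_out.
have qpn : q - p != n by apply: contraNneq qn => <-; rewrite subrK.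
by have := psi_fil (gr_repr_out Fil x qpn); congr (Fil _ _); lia.
Qed.

Lemma gr_endo_mode (a b : Gr Fil) k : gr_endo (mode a k b) = mode a k (gr_endo b : Gr Fil).
Proof.
rewrite !Gr_mode; have [sA [uA aA]] := gr_finite a; have [sB [uB bB]] := gr_finite b.
have cB m : m \notin [seq n + p | n <- sB] -> Fil (m - 1) (gr_repr (gr_endo b) m).
  move=> mB; have mB' : m - p \notin sB.
    by apply: contra mB => mB; apply/mapP; exists (m - p) => //; rewrite subrK.
  rewrite -[gr_repr _ _](subrK (psi (gr_repr b (m - p)))); apply: filD.
    exact: gr_endo_repr.
  by have := psi_fil (bB _ mB'); congr (Fil _ _); lia.
have ucB : uniq [seq n + p | n <- sB] by rewrite map_inj_uniq//; exact: addIr.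
rewrite (gr_mode_sum _ uA uB aA bB) (gr_mode_sum _ uA ucB aA cB).
pose psi' := to_linear gr_endo_linear.
rewrite -[LHS]/(psi' _) linear_sum; apply: eq_bigr => m _.
rewrite linear_sum big_map; apply: eq_bigr => n _ /=.
have am := gr_repr_fil a m; have bn := gr_repr_fil b n.
rewrite gr_endo_in; last exact: fil_mode.
rewrite (_ : m + (n + p) - 2 * k - 2 = m + n - 2 * k - 2 + p); last by lia.
have psib : Fil (n + p - 1) (psi (gr_repr b n) - gr_repr (gr_endo b) (n + p)).
  by have := gr_endo_repr b (n + p); rewrite addrK => /filBC.
apply: gr_in_eq; rewrite ?psi_mode.
- by have := fil_mode hFil k am (psi_fil bn); congr (Fil _ _); lia.
- by have := fil_mode hFil k am (gr_repr_fil (gr_endo b) (n + p)); congr (Fil _ _); lia.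
- by rewrite -modeBr; have := fil_mode hFil k am psib; congr (Fil _ _); lia.
Qed.
End ShiftEndo.

Hypothesis endGr : End_eq_t (Gr Fil).

Lemma End_of_graded : End_eq_t V.
Proof.
have [N bN] := fil_bounded hFil.
suff H d : forall (psi : {linear V -> V}) p, p < N + d%:Z ->
    (forall v n w, psi (mode v n w) = mode v n (psi w)) -> Fil p (psi vac) ->
    exists f, forall w, psi w = tact f w.
  move=> psi psi_mode; have [p pv] := fil_union hFil (psi vac).
  by apply: (H (absz (p - N)).+1 psi p) => //; lia.
elim: d => [|d IH] psi p pN psi_mode psi_p.
  have psi0 : psi vac = 0 by apply: (bN p) => //; lia.
  exists 0 => w; rewrite (biadd0l (tact_biadditive hV)) -[w](mode_vac hV) psi_mode psi0.
  by rewrite /mode (biadd0r (vY_biadditive hV)).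
(* As x = x_{-1} 1, psi(x) = x_{-1} psi(1), and a mode of index -1 adds the filtration degrees. *)
have psi_fil n x : Fil n x -> Fil (n + p) (psi x).
  move=> nx; rewrite -[x](mode_vac hV) psi_mode.
  by have := fil_mode hFil (-1) nx psi_p; congr (Fil _ _); lia.
have [f fE] := endGr (psi := to_linear (gr_endo_linear psi_fil))
  (fun a k b => gr_endo_mode psi_fil psi_mode a b k).
have vac0 := fil_vac hFil; have ft : Fil 0 (tact f vac) by exact: fil_tact.
have e : gr_in Fil p (psi vac) = gr_in Fil 0 (tact f vac).
  have := fE (gr_in Fil 0 vac); rewrite (Gr_tactE hV hFil)//= gr_endo_in// add0r.
  exact.
(* For p nonzero, the classes of psi(1) and f 1 agree but lie in different degrees, so both vanish
   and psi(1) drops one step. *)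
have [p0|p0] := eqVneq p 0; last first.
  apply: (IH psi (p - 1)) => //; first by lia.
  rewrite -[psi vac](subKr (gr_repr (gr_in Fil p (psi vac)) p)); apply: filB.
    by rewrite e; exact: gr_repr_out.
  exact: gr_repr_in.
have psi1_lin : linear (fun w => psi w - tact f w).
  move=> c x y; rewrite linearP (tact_linear hV) scalerBr opprD.
  by rewrite addrACA.
have [g gE] : exists g, forall w, psi w - tact f w = tact g w.
  (* For p = 0 the two classes agree in degree 0, so psi - f sends the vacuum into [Fil (-1)], which
     is F_{-1/2}. *)
  apply: (IH (to_linear psi1_lin) (- 1)); first by lia.
    by move=> v n w /=; rewrite psi_mode -(mode_tact hV) modeBr.
  have := gr_repr_in psi_p; rewrite e p0 => /filBC h; exact: filB_trans h (gr_repr_in ft).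
exists (g + f) => w; rewrite (proj1 (tact_biadditive hV)) -gE subrK//.
Qed.
End Graded.

Theorem proposition3p8 (F : fieldType) (charF : [pchar F] =i pred0)
    (V : vdata F) (hV : is_nonlocal_tva V)
    (Fil : int -> submod V) (hFil : is_filtration Fil)
    (hirr : is_irreducible (Gr Fil)) (hEnd : End_eq_t (Gr Fil)) :
  is_irreducible V /\ End_eq_t V /\ is_nondegenerate V.
Proof.
have irr := irreducible_of_graded hV hFil hirr.
have endV := End_of_graded hV hFil hEnd.
split=> //; split=> // n _; have [Z ZE] := Z_exists charF hV n.
by exists Z; split=> //; exact: (Z_injective charF hV irr endV ZE).
Qed.
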